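(* Let $[X,\mathcal B,m,\nu]$ be a reversible random walk space, $p>1$, and for each $x$ let $A_x,B_x\subset\mathrm{supp}(m_x)$ be non-null measurable sets with $A_x\cup B_x=\mathrm{supp}(m_x)$ (as in the context). Assume either (a) $\nu(X)<\infty$, or (b) $\nu(X)=+\infty$ and $p\ge2$. Then $$\partial_{L^2(X,\nu)}\big(\mathcal F_{A,1,m}+\mathcal F_{B,p,m}\big)=\partial_{L^2(X,\nu)}\mathcal F_{A,1,m}+\partial_{L^2(X,\nu)}\mathcal F_{B,p,m}=-\Delta_{1,A}^m-\Delta_{p,B}^m.$$ Furthermore, this operator is completely accretive and has dense domain in $L^2(X,\nu)$.
   Context: A random walk space $[X,\mathcal B,m,\nu]$: measurable space with countably generated $\sigma$-algebra, probability measures $m_x$ with $x\mapsto m_x(B)$ measurable, $\sigma$-finite invariant $\nu$ ($\nu(A)=\int m_x(A)\,d\nu(x)$); reversible: $dm_x(y)d\nu(x)=dm_y(x)d\nu(y)$. $\nu\otimes m_x$ is the measure $dm_x(y)d\nu(x)$ on $X\times X$; $\nabla u(x,y)=u(y)-u(x)$. The sets $\{(x,y):y\in A_x\}$, $\{(x,y):y\in B_x\}$ are measurable; $K_A(x,y)=\frac12(\chi_{A_x}(y)+\chi_{A_y}(x))$, $K_B(x,y)=\frac12(\chi_{B_x}(y)+\chi_{B_y}(x))$. On $L^2(X,\nu)$: $\mathcal F_{A,1,m}(u)=\frac12\int|\nabla u|K_A\,d(\nu\otimes m_x)$, $\mathcal F_{B,p,m}(u)=\frac1{2p}\int|\nabla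 u|^pK_B\,d(\nu\otimes m_x)$, each $+\infty$ if infinite. $\partial$ is the convex subdifferential; sum of operators is $\{(u,v_1+v_2):(u,v_i)\in A_i\}$. $(u,v)\in\Delta_{1,A}^m$ iff $(u,-v)\in\partial_{L^2(X,\nu)}\mathcal F_{A,1,m}(u)$. $(u,v)\in\Delta_{p,B}^m$ iff $u,v\in L^2(X,\nu)$, $\int K_B|\nabla u|^p\,d(\nu\otimes m_x)<\infty$ and $v(x)=\int_XK_B(x,y)|\nabla u(x,y)|^{p-2}\nabla u(x,y)\,dm_x(y)$. Complete accretivity of $A\subset L^2\times L^2$: for all $\lambda>0$, $(u_1,v_1),(u_2,v_2)\in A$, $\int j(u_1-u_2)\,d\nu\le\int j(u_1-u_2+\lambda(v_1-v_2))\,d\nu$ for all convex lower semicontinuous $j:\mathbb R\to[0,\infty]$ with $j(0)=0$. *)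

(* Defs.v *)
From HB Require Import structures.
From mathcomp Require Import all_boot all_order all_algebra.
From mathcomp Require Import all_classical all_reals all_analysis measurable_realfun.
Set Implicit Arguments. Unset Strict Implicit. Unset Printing Implicit Defensive.
Import Order.TTheory GRing.Theory Num.Theory.
Import numFieldNormedType.Exports.
Local Open Scope classical_set_scope.
Local Open Scope ring_scope.

Section RWS.
Context {d : measure_display} {X : measurableType d} {R : realType}.

Definition countably_generated :=
  exists G : (set X)^nat, (@measurable d X) = <<s range G>>.

Definition kernel_measurable (m : X -> probability X R) :=
  forall B, measurable B -> measurable_fun [set: X] ((fun x => m x B) : X -> \bar R).

Definition nuxm (nu : {measure set X -> \bar R}) (m : X -> probability X R)
  (f : X * X -> \bar R) : \bar R :=
  (\int[nu]_x \int[m x]_y f (x, y))%E.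

Definition nu_invariant (nu : {measure set X -> \bar R}) (m : X -> probability X R) :=
  forall A, measurable A -> nu A = (\int[nu]_x m x A)%E.

Definition nu_reversible (nu : {measure set X -> \bar R}) (m : X -> probability X R) :=
  forall C : set (X * X), measurable C ->
    nuxm nu m (fun xy => (\1_C xy)%:E) = nuxm nu m (fun xy => (\1_C (xy.2, xy.1))%:E).

Definition grad (u : X -> R) (xy : X * X) : R := u xy.2 - u xy.1.

Definition Kset (A : X -> set X) (xy : X * X) : R :=
  2^-1 * (\1_(A xy.1) xy.2 + \1_(A xy.2) xy.1).

Definition FA1 nu m (A : X -> set X) (u : X -> R) : \bar R :=
  ((2^-1)%:E * nuxm nu m (fun xy => (`|grad u xy| * Kset A xy)%:E))%E.

Definition FBp nu m (B : X -> set X) (p : R) (u : X -> R) : \bar R :=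
  (((2 * p)^-1)%:E * nuxm nu m (fun xy => (powR `|grad u xy| p * Kset B xy)%:E))%E.

(* u belongs to L^2(X, nu) (a representative of the class) *)
Definition L2 (nu : {measure set X -> \bar R}) (u : X -> R) :=
  measurable_fun setT u /\ (\int[nu]_x (`|u x| ^+ 2)%:E < +oo)%E.

(* operators on L^2 as relations: op u v means (u,v) in the operator *)
Definition op := (X -> R) -> (X -> R) -> Prop.

Definition subdiff nu (F : (X -> R) -> \bar R) : op := fun u v =>
  L2 nu u /\ L2 nu v /\ (F u < +oo)%E /\
  forall w, L2 nu w ->
    (F u + \int[nu]_x (v x * (w x - u x))%:E <= F w)%E.

Definition opadd (A1 A2 : op) : op := fun u v =>
  exists v1 v2, A1 u v1 /\ A2 u v2 /\ v = v1 \+ v2.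

Definition opneg (A : op) : op := fun u v => A u (\- v).

Definition Lap1 nu m (A : X -> set X) : op := fun u v =>
  subdiff nu (FA1 nu m A) u (\- v).

Definition Lapp nu m (B : X -> set X) (p : R) : op := fun u v =>
  L2 nu u /\ L2 nu v /\
  (nuxm nu m (fun xy => (Kset B xy * powR `|grad u xy| p)%:E) < +oo)%E /\
  {ae nu, forall x, (v x)%:E =
     (\int[m x]_y (Kset B (x, y) * powR `|grad u (x, y)| (p - 2) * grad u (x, y))%:E)%E}.

Definition admissible_j (j : R -> \bar R) :=
  (forall t, (0 <= j t)%E) /\ j 0 = 0%E /\
  (forall x y t : R, (0 < t < 1)%R ->
     (j (t * x + (1 - t) * y)%R <= t%:E * j x + (1 - t)%R%:E * j y)%E) /\
  (forall a : R, closed [set t | (j t <= a%:E)%E]).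

Definition completely_accretive nu (A : op) :=
  forall lam : R, 0 < lam -> forall u1 v1 u2 v2, A u1 v1 -> A u2 v2 ->
  forall j, admissible_j j ->
    (\int[nu]_x j (u1 x - u2 x)%R <= \int[nu]_x j (u1 x - u2 x + lam * (v1 x - v2 x))%R)%E.

Definition dense_domain nu (A : op) :=
  forall f, L2 nu f -> forall e : R, 0 < e ->
    exists u v, A u v /\ (\int[nu]_x (`|u x - f x| ^+ 2)%:E < e%:E)%E.

End RWS.

(* Main.v *)
Require Import Defs.
From HB Require Import structures.
From mathcomp Require Import all_boot all_order all_algebra.
From mathcomp Require Import all_classical all_reals all_analysis measurable_realfun.
From mathcomp Require Import ring lra.
Set Implicit Arguments. Unset Strict Implicit. Unset Printing Implicit Defensive.
Import Order.TTheory GRing.Theory Num.Theory.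
Import numFieldNormedType.Exports.
Local Open Scope classical_set_scope.
Local Open Scope ring_scope.

(** Write [M] for the measure [nu (x) m_x] on [X * X], [psi t = |t|^(p-2) t] and
    [D u x = \int psi (grad u) K_B dm_x].  Reversibility makes [M] symmetric, so
    [2^-1 \int_M g (grad h) = - \int (\int g dm_x) h dnu] for antisymmetric [g].

    Let [v] be in the subdifferential of the sum at [u].  The p-functional has
    directional derivatives, hence [\int v h <= F_A (u + h) - F_A u - \int (D u) h]
    for bounded [h].  Testing with [h = +- 1_E] gives [|v + D u| <= 1] almost
    everywhere, since [F_A 1_E <= nu E].  This bound is what puts [D u] in [L^2]:
    at once if [nu] is finite, and for [p >= 2] because [D u] is dominated by the
    sum of an [L^2] and an [L^1] function.  Truncating the competitors then shows
    that [v + D u] belongs to the subdifferential of [F_A]; the case of an empty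
    [A] identifies the subdifferential of [F_B].

    Complete accretivity: if [T] is nondecreasing and 1-Lipschitz, replacing
    [(u1, u2)] by [(u1 - T (u1 - u2), u2 + T (u1 - u2))] decreases [F u1 + F u2],
    so [\int (v1 - v2) T (u1 - u2) >= 0].  Apply this to the derivatives of the
    Moreau envelopes of [j], which increase to [j].

    Density: a bounded function [u] with support of finite measure is in the
    domain, with [- \int sgn (grad u) K_A dm_x - D u] as a subgradient. *)

(** * Integrals of real functions *)

(** What rescues the sum rule is that [FA1] is controlled by the [L1] norm: its subgradients are
    bounded by [1], so an element of the subdifferential of the sum stays within a bounded function
    of the p-part. Until this is known, [lap u] is only a measurable function and the flux
    integrates against bounded functions only; this is why tests are bounded at first and general
    competitors are reached by truncation. The alternative on [nu] and [p] is what gives bounded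
    square integrable functions a finite p-energy. For accretivity [j] itself cannot be
    differentiated: it may be infinite or have corners, and [j (u1 - u2)] comes with no
    integrability. Its Moreau envelopes are dominated by a quadratic, and their derivative is a
    constant times a nondecreasing 1-Lipschitz map vanishing at [0], exactly the kind of [T] that
    the exchange argument accepts. *)

Section real_integral.
Context {d : measure_display} {T : measurableType d} {R : realType}.
Variable mu : {measure set T -> \bar R}.
Implicit Types f g : T -> R.

Definition rintegrable f := mu.-integrable setT (EFin \o f).

Lemma rintegrable_measurable f : rintegrable f -> measurable_fun setT f.
Proof. by move=> /measurable_int /measurable_EFinP. Qed.

Lemma rintegrable_le f g : measurable_fun setT f -> rintegrable g ->
  (forall x, `|f x| <= g x) -> rintegrable f.
Proof.
move=> mf ig fg; apply: le_integrable ig => //; first exact/measurable_EFinP.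
by move=> x _; rewrite /= lee_fin (le_trans (fg x))// ler_norm.
Qed.

Lemma rintegrable_ge0 f : measurable_fun setT f -> (forall x, 0 <= f x) ->
  (\int[mu]_x (f x)%:E < +oo)%E -> rintegrable f.
Proof.
move=> mf f0 fy; apply/integrableP; split; first exact/measurable_EFinP.
by under eq_integral do rewrite gee0_abs ?lee_fin//.
Qed.

Lemma rintegralE f : rintegrable f ->
  (\int[mu]_x (f x)%:E)%E = (\int[mu]_x f x)%:E.
Proof. by move=> fi; rewrite fineK//; exact: integrable_fin_num fi. Qed.

Lemma rintegrable_lty f : rintegrable f -> (\int[mu]_x (f x)%:E < +oo)%E.
Proof. by move=> fi; rewrite rintegralE// ltry. Qed.

Lemma rintegrableD f g : rintegrable f -> rintegrable g ->
  rintegrable (fun x => f x + g x).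
Proof. by move=> fi gi; exact: (integrableD measurableT fi gi). Qed.

Lemma rintegrableB f g : rintegrable f -> rintegrable g ->
  rintegrable (fun x => f x - g x).
Proof. by move=> fi gi; exact: (integrableB measurableT fi gi). Qed.

Lemma rintegrableZ k f : rintegrable f -> rintegrable (fun x => k * f x).
Proof. by move=> fi; exact: (integrableZl measurableT k fi). Qed.

Lemma rintegrableN f : rintegrable f -> rintegrable (fun x => - f x).
Proof.
by move=> fi; under eq_fun do rewrite -mulN1r; exact: rintegrableZ.
Qed.

Lemma rintegrable_abs f : rintegrable f -> rintegrable (fun x => `|f x|).
Proof. by move=> fi; exact: (integrable_norm fi). Qed.

Lemma rintegralD f g : rintegrable f -> rintegrable g ->
  \int[mu]_x (f x + g x) = \int[mu]_x f x + \int[mu]_x g x.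
Proof. by move=> fi gi; exact: RintegralD. Qed.

Lemma rintegralB f g : rintegrable f -> rintegrable g ->
  \int[mu]_x (f x - g x) = \int[mu]_x f x - \int[mu]_x g x.
Proof. by move=> fi gi; exact: RintegralB. Qed.

Lemma rintegralZ k f : rintegrable f ->
  \int[mu]_x (k * f x) = k * \int[mu]_x f x.
Proof. by move=> fi; exact: RintegralZl. Qed.

Lemma rintegralN f : rintegrable f -> \int[mu]_x (- f x) = - \int[mu]_x f x.
Proof.
move=> fi; rewrite -mulN1r -rintegralZ//.
by apply: eq_Rintegral => x _; rewrite mulN1r.
Qed.

Lemma le_rintegral f g : rintegrable f -> rintegrable g ->
  (forall x, f x <= g x) -> \int[mu]_x f x <= \int[mu]_x g x.
Proof. by move=> fi gi fg; apply: le_Rintegral => // x _. Qed.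

Lemma rdominated_convergence (f_ : nat -> T -> R) f g :
  (forall n, measurable_fun setT (f_ n)) ->
  (forall x, f_ n x @[n --> \oo] --> f x) ->
  rintegrable g -> (forall n x, `|f_ n x| <= g x) ->
  rintegrable f /\ \int[mu]_x f_ n x @[n --> \oo] --> \int[mu]_x f x.
Proof.
move=> mf_ f_f gi f_g.
have mf : measurable_fun setT f by exact: (measurable_fun_cvg mf_ (fun x _ => f_f x)).
have fi n : rintegrable (f_ n) by exact: rintegrable_le (mf_ n) gi (f_g n).
have [||||i _ cv] := @dominated_convergence _ _ _ mu _ measurableT
  (fun n => EFin \o f_ n) (EFin \o f) (EFin \o g) _ _ _ gi _.
- by move=> n; exact/measurable_EFinP.
- exact/measurable_EFinP.
- apply: aeW => x _; apply/cvg_EFin; last exact: f_f.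
  by apply: nearW => n.
- by apply: aeW => x n _; rewrite /= lee_fin.
split=> //; move: cv; rewrite rintegralE// => /fine_cvg; exact.
Qed.

Lemma rintegrable_ae_eq f g : measurable_fun setT g ->
  {ae mu, forall x, f x = g x} -> rintegrable f -> rintegrable g.
Proof.
move=> mg fg fi; have mf := rintegrable_measurable fi.
apply/integrableP; split; first exact/measurable_EFinP.
have /integrableP[_] := fi; congr (_ < _)%E.
apply: ge0_ae_eq_integral => //.
- by apply: measurableT_comp => //; exact/measurable_EFinP.
- by apply: measurableT_comp => //; exact/measurable_EFinP.
- by move: fg; apply: filterS => x /= -> _.
Qed.

Lemma rintegral_ae_eq f g : measurable_fun setT f -> measurable_fun setT g ->
  {ae mu, forall x, f x = g x} -> \int[mu]_x f x = \int[mu]_x g x.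
Proof.
move=> mf mg fg; congr fine; apply: ae_eq_integral => //.
- exact/measurable_EFinP.
- exact/measurable_EFinP.
- by move: fg; apply: filterS => x /= -> _.
Qed.

Lemma rintegrable_le_ae f g : measurable_fun setT f -> rintegrable g ->
  {ae mu, forall x, `|f x| <= g x} -> rintegrable f.
Proof.
move=> mf ig fg; apply/integrableP; split; first exact/measurable_EFinP.
have /integrableP[_] := ig; apply: le_lt_trans.
have mabs (h : T -> R) : measurable_fun setT h -> measurable_fun setT (abse \o (EFin \o h)).
  by move=> mh; apply: measurableT_comp => //; exact/measurable_EFinP.
apply: ae_ge0_le_integral => //; [exact: mabs|exact/mabs/rintegrable_measurable|].
move: fg; apply: filterS => x h _ /=.
by rewrite lee_fin (le_trans h)// ler_norm.
Qed.

Lemma rintegral_ge0_eq0 f : rintegrable f -> (forall x, 0 <= f x) ->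
  \int[mu]_x f x <= 0 -> {ae mu, forall x, f x = 0}.
Proof.
move=> fi f0 fle; have mf : measurable_fun setT (EFin \o f) by exact: measurable_int fi.
have : (\int[mu]_x `|(EFin \o f) x| = 0)%E.
  under eq_integral do rewrite gee0_abs ?lee_fin//.
  rewrite rintegralE//; congr EFin; apply/eqP; rewrite eq_le fle.
  exact: Rintegral_ge0.
move/(ae_eq_integral_abs mu measurableT mf); apply: filterS => x /(_ I).
by move=> [].
Qed.

(* No integrability is needed: when [f] is not integrable and [k != 0], both
   sides are [fine] of an infinite value, that is [0]. *)
Lemma rintegralZ_total k f : measurable_fun setT f ->
  \int[mu]_x (k * f x) = k * \int[mu]_x f x.
Proof.
move=> mf; have [->|k0] := eqVneq k 0.
  by under eq_Rintegral do rewrite mul0r; rewrite Rintegral_cst// !mul0r.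
have [fi|fi] := boolP (mu.-integrable setT (EFin \o f)).
  exact: rintegralZ.
have int0 g : measurable_fun setT g -> ~~ mu.-integrable setT (EFin \o g) ->
    \int[mu]_x g x = 0.
  move=> mg; have mEg : measurable_fun setT (EFin \o g) by exact/measurable_EFinP.
  rewrite /Rintegral.
  case E : (\int[mu]_x (g x)%:E)%E => [r| |]//= /negP[].
  by apply/integrableP; split=> //; apply/abse_integralP; rewrite //= E ltry.
rewrite [in RHS]int0// mulr0 int0//; first exact: measurable_funM.
apply: contra fi => /(integrableZl measurableT k^-1).
by apply: eq_integrable => // x _; rewrite /= -EFinM mulKf.
Qed.

End real_integral.

(** * The power function and truncation *)

Section scalar.
Context {R : realType}.
Implicit Types (p s t a b c : R).

Definition psi p t : R := `|t| `^ (p - 2) * t.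

Section psi_theory.
Variable p : R.
Hypothesis p1 : 1 < p.

Let p0 : 0 < p. Proof. exact: lt_trans p1. Qed.
Let pm1 : 0 < p - 1. Proof. by rewrite subr_gt0. Qed.

Lemma norm_psi t : `|psi p t| = `|t| `^ (p - 1).
Proof.
rewrite /psi normrM (ger0_norm (powR_ge0 _ _)) mulrC.
rewrite -(mulr_powRB1 (normr_ge0 t) pm1); congr (_ * _ `^ _); lra.
Qed.

Lemma psi_mulr t : psi p t * t = `|t| `^ p.
Proof.
rewrite /psi -mulrA -expr2 -real_normK ?num_real// expr2 mulrA.
rewrite -{2}[`|t|]ger0_norm// -[X in X * _]ger0_norm ?mulr_ge0 ?powR_ge0//.
rewrite -{2}[`|t|]normr_id; have := norm_psi `|t|.
rewrite /psi !normr_id => ->; rewrite mulrC mulr_powRB1//.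
Qed.

Lemma psiN t : psi p (- t) = - psi p t.
Proof. by rewrite /psi normrN mulrN. Qed.

(** Young's inequality for the conjugate exponents [q = p / (p - 1)] and [p]: since [(p - 1) q = p],
    the first factor becomes [|a|^p]. *)
Lemma young_powR a b :
  `|a| `^ (p - 1) * `|b| <= `|a| `^ p * (1 - p^-1) + `|b| `^ p / p.
Proof.
pose q := p / (p - 1).
have q0 : 0 < q by rewrite divr_gt0.
have pq : p^-1 + q^-1 = 1.
  by rewrite /q invf_div; field; rewrite gt_eqF.
have := conjugate_powR (normr_ge0 b) (powR_ge0 `|a| (p - 1)) p0 q0 pq.
rewrite -powRrM (_ : (p - 1) * q = p); last by rewrite /q; field; rewrite gt_eqF.
have -> : 1 - p^-1 = q^-1 by rewrite -pq addrC addKr.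
by move=> h; rewrite mulrC [leRHS]addrC.
Qed.

(** [p * psi p] is the derivative of [|.|^p]. Since [psi p t * t = |t|^p], the claim is [p] times
    Young's inequality for [|t|^(p-1) |s|], which avoids differentiation and covers [t = 0]. *)
Lemma psi_subgradient s t : `|t| `^ p + p * (psi p t * (s - t)) <= `|s| `^ p.
Proof.
have h : psi p t * s <= `|t| `^ (p - 1) * `|s|.
  by rewrite -norm_psi -normrM ler_norm.
have := le_trans h (young_powR t s).
rewrite -(ler_pM2l p0) => {}h; rewrite mulrBr psi_mulr mulrBr.
apply: le_trans (lerD (lexx _) (lerB h (lexx _))) _.
rewrite le_eqVlt; apply/orP; left; apply/eqP; field.
by rewrite gt_eqF.
Qed.

Lemma psi_young a b : `|psi p a * b| <= `|a| `^ p + `|b| `^ p.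
Proof.
rewrite normrM norm_psi (le_trans (young_powR a b))// lerD//.
  rewrite ler_piMr ?powR_ge0// gerBl invr_ge0; exact: ltW.
by rewrite ler_piMr ?powR_ge0// invf_le1// ltW.
Qed.

Lemma powR_add_le a b : `|a + b| `^ p <= 2 `^ p * (`|a| `^ p + `|b| `^ p).
Proof.
wlog ab : a b / `|b| <= `|a|.
  by move=> h; have [/h//|/ltW/h] := leP `|b| `|a|; rewrite addrC [X in _ * X]addrC.
have h : `|a + b| <= 2 * `|a| by rewrite (le_trans (ler_normD a b))//; lra.
apply: le_trans (ge0_ler_powR (ltW p0) _ _ h) _; rewrite ?nnegrE ?mulr_ge0//.
by rewrite powRM// ler_wpM2l ?powR_ge0// lerDl powR_ge0.
Qed.

Lemma powR_le_norm a b : `|a| <= `|b| -> `|a| `^ p <= `|b| `^ p.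
Proof. by move=> ab; apply: ge0_ler_powR => //; rewrite ?nnegrE// ltW. Qed.

Lemma psi_continuous : continuous (psi p).
Proof.
move=> t; have [->|t0] := eqVneq t 0; last first.
  apply: (@cvgM _ _ _ _ (fun s => `|s| `^ (p - 2)) id); last exact: cvg_id.
  apply: (@continuous_comp _ _ _ (fun s : R => `|s|) (@powR R ^~ (p - 2))).
    exact: norm_continuous.
  apply/differentiable_continuous/derivable1_diffP/derivable_powR.
  by rewrite in_itv/= andbT normr_gt0.
(* At [0] the factor [|t|^(p-2)] may blow up, but [|psi p t| = |t|^(p-1)] with [p - 1 > 0], so
   [|s| < e^(1/(p-1))] is enough. *)
rewrite /continuous_at (_ : psi p 0 = 0); last by rewrite /psi mulr0.
apply/cvgrPdist_lt => e e0; near=> s.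
rewrite sub0r normrN norm_psi.
have -> : e = (e `^ (p - 1)^-1) `^ (p - 1).
  by rewrite -powRrM mulVf ?gt_eqF// powRr1// ltW.
apply: gt0_ltr_powR => //; rewrite ?nnegrE ?powR_ge0//.
by near: s; apply: (@cvgr0_norm_lt _ _ _ _ _ id) => //; exact: powR_gt0.
Unshelve. all: by end_near. Qed.

Lemma measurable_psi : measurable_fun setT (psi p).
Proof. exact: continuous_measurable_fun psi_continuous. Qed.

End psi_theory.

(** A contraction fixing [0]: composing with it increases neither the [L2] norm nor [|grad u|], and
    makes the function bounded. *)
Definition clamp c t : R := Num.max (- c) (Num.min c t).

Lemma clampP c t : 0 <= c ->
  [\/ t <= - c /\ clamp c t = - c, c <= t /\ clamp c t = c |
     - c <= t <= c /\ clamp c t = t].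
Proof.
move=> c0; rewrite /clamp; case: (leP c t) => ct.
  by apply: Or32; rewrite max_r//; lra.
have [ct'|ct'] := leP (- c) t; last by apply: Or31; split=> //; lra.
by apply: Or33; split=> //; apply/andP; split=> //; exact: ltW.
Qed.

Lemma clamp_le c t : 0 <= c -> `|clamp c t| <= c.
Proof.
move=> c0; rewrite ler_norml.
by case: (clampP t c0) => -[? ->]; lra.
Qed.

Lemma clamp_contract c s t : 0 <= c -> `|clamp c s - clamp c t| <= `|s - t|.
Proof.
move=> c0; rewrite ler_norml; case: (ger0P (s - t)) => ?;
  by case: (clampP s c0) => -[? ->]; case: (clampP t c0) => -[? ->]; lra.
Qed.

Lemma clamp0 c : 0 <= c -> clamp c 0 = 0.
Proof. by move=> c0; rewrite /clamp min_r// max_r// oppr_le0. Qed.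

Lemma clamp_norm_le c t : 0 <= c -> `|clamp c t| <= `|t|.
Proof.
by move=> c0; have := clamp_contract t 0 c0; rewrite clamp0// !subr0.
Qed.

Lemma clamp_id c t : `|t| <= c -> clamp c t = t.
Proof. by rewrite ler_norml => /andP[h1 h2]; rewrite /clamp min_r// max_r. Qed.

Lemma cvg_clamp t : clamp n%:R t @[n --> \oo] --> t.
Proof.
apply: cvg_near_cst; near=> n; apply: clamp_id.
by near: n; exact: nbhs_infty_ger.
Unshelve. all: by end_near. Qed.

Lemma measurable_clamp c : measurable_fun setT (clamp c).
Proof. by apply: measurable_maxr => //; apply: measurable_minr. Qed.

End scalar.

(** * The measure [nu (x) m_x] *)

Section graph_measure.
Context {d : measure_display} {X : measurableType d} {R : realType}.
Variables (nu : {measure set X -> \bar R}) (m : X -> probability X R).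
Hypothesis hm : kernel_measurable m.
Implicit Types (f : X * X -> \bar R) (C : set (X * X)).
Local Open Scope ereal_scope.

Let mker (x : X) : {measure set X -> \bar R} := m x.

HB.instance Definition _ := isKernel.Build _ _ X X R mker hm.

Let mkerT x : mker x setT = 1. Proof. exact: probability_setT. Qed.

HB.instance Definition _ := Kernel_isProbability.Build _ _ X X R mker mkerT.

Lemma measurable_kernel_integral f : (forall z, 0 <= f z) ->
  measurable_fun setT f ->
  measurable_fun setT (fun x => \int[m x]_y f (x, y)).
Proof.
by move=> f0 mf; exact: (measurable_fun_integral_finite_kernel f mker f0 mf).
Qed.

Lemma measurable_fun_section d1 (T : measurableType d1) (f : X * X -> T) x :
  measurable_fun setT f -> measurable_fun setT (fun y => f (x, y)).
Proof. by move=> mf; exact: measurableT_comp mf (measurable_pair1 x). Qed.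

Lemma measurable_fun_indicE C : measurable C ->
  measurable_fun setT (fun z : X * X => (\1_C z)%:E : \bar R).
Proof. by move=> mC; exact/measurable_EFinP/measurable_indic. Qed.

(** The measurability of the kernel is an argument so that the measure structure, whose additivity
    rests on it, can be inferred from the term. *)
Definition graph_measure (_ : kernel_measurable m) C : \bar R :=
  nuxm nu m (fun z => (\1_C z)%:E).

Let graph0 : graph_measure hm set0 = 0.
Proof.
by apply: integral0_eq => x _; apply: integral0_eq => y _; rewrite indic0.
Qed.

Let graph_ge0 C : 0 <= graph_measure hm C.
Proof.
by apply: integral_ge0 => x _; apply: integral_ge0 => y _; rewrite lee_fin.
Qed.

Let graph_additive : semi_sigma_additive (graph_measure hm).
Proof.
move=> F mF tF mUF.
rewrite (_ : graph_measure hm (\bigcup_n F n)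
    = \sum_(i <oo) graph_measure hm (F i)).
  by apply: is_cvg_ereal_nneg_natsum => i _.
rewrite /graph_measure /nuxm -integral_nneseries//=; last 2 first.
- move=> n; apply: measurable_kernel_integral (measurable_fun_indicE (mF n)).
  by move=> z; rewrite lee_fin.
- by move=> n x _; apply: integral_ge0 => y _; rewrite lee_fin.
apply: eq_integral => x _; rewrite -integral_nneseries//.
- by apply: eq_integral => y _; rewrite indic_bigcup.
- by move=> n; exact: measurable_fun_section (measurable_fun_indicE (mF n)).
Qed.

HB.instance Definition _ := isMeasure.Build _ _ R (graph_measure hm)
  graph0 graph_ge0 graph_additive.

Definition nuxm_measure : {measure set (X * X) -> \bar R} := graph_measure hm.

Import HBNNSimple.

Let integral_nuxm_nnsfun (f : {nnsfun (X * X) >-> R}) :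
  \int[nuxm_measure]_z (f z)%:E = nuxm nu m (fun z => (f z)%:E).
Proof.
have mE r : measurable_fun setT (fun z => (r * \1_(f @^-1` [set r]) z)%:E).
  under eq_fun do rewrite EFinM.
  exact: measurable_funeM (measurable_fun_indicE _).
have E0 r z : 0 <= (r * \1_(f @^-1` [set r]) z)%:E.
  by rewrite EFinM nnfun_muleindic_ge0.
transitivity (\sum_(r \in range f)
    nuxm nu m (fun z => (r * \1_(f @^-1` [set r]) z)%:E)); last first.
  rewrite /nuxm -ge0_integral_fsum//; last 2 first.
  - by move=> r; exact: measurable_kernel_integral (E0 r) (mE r).
  - by move=> r x _; exact: integral_ge0.
  apply: eq_integral => x _; rewrite -ge0_integral_fsum//.
  - by apply: eq_integral => y _; rewrite fsumEFin// -fimfunE.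
  - by move=> r; exact: measurable_fun_section (mE r).
under eq_integral do rewrite fimfunE -fsumEFin//.
rewrite ge0_integral_fsum//; apply: eq_fsbigr => r _.
have [r0|r0] := leP 0%R r; last first.
  have e0 z : (r * \1_(f @^-1` [set r]) z)%:E = 0.
    by rewrite preimage_nnfun0// indic0 mulr0.
  rewrite integral0_eq//; apply/esym/integral0_eq => x _.
  by apply: integral0_eq => y _; rewrite e0.
under eq_integral do rewrite EFinM.
rewrite ge0_integralZl//; last exact: measurable_fun_indicE.
rewrite integral_indic// setIT /= /graph_measure /nuxm.
rewrite -ge0_integralZl//; last 2 first.
- by apply: measurable_kernel_integral (measurable_fun_indicE _) => //.
- by move=> x _; apply: integral_ge0.
apply: eq_integral => x _.
rewrite -ge0_integralZl//.
exact: measurable_fun_section (measurable_fun_indicE _).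
Qed.

(** Tonelli for the iterated integral: both sides agree on indicators by definition of the measure,
    hence on simple functions, hence on their increasing limits. *)
Lemma ge0_integral_nuxm f : (forall z, 0 <= f z) -> measurable_fun setT f ->
  \int[nuxm_measure]_z f z = nuxm nu m f.
Proof.
move=> f0 mf; pose f_ := nnsfun_approx measurableT mf.
have f_f z : (f_ n z)%:E @[n --> \oo] --> f z by exact: cvg_nnsfun_approx.
have mf_ n : measurable_fun setT (fun z => (f_ n z)%:E) by exact/measurable_EFinP.
have ndf_ z : nondecreasing_seq (fun n => (f_ n z)%:E).
  by move=> a b ab; rewrite lee_fin; exact/lefP/nd_nnsfun_approx.
have limE z : f z = limn (fun n => (f_ n z)%:E) by apply/esym/cvg_lim.
under eq_integral do rewrite limE.
rewrite monotone_convergence//; last by move=> n z _; rewrite lee_fin.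
under eq_fun do rewrite integral_nuxm_nnsfun.
rewrite /nuxm -monotone_convergence//; last 3 first.
- move=> n; apply: measurable_kernel_integral (mf_ n).
  by move=> z; rewrite lee_fin.
- by move=> n x _; apply: integral_ge0 => y _; rewrite lee_fin.
- move=> x _ a b ab; apply: ge0_le_integral => //.
  + by move=> y _; rewrite lee_fin.
  + exact: measurable_fun_section (mf_ a).
  + exact: measurable_fun_section (mf_ b).
  + by move=> y _; exact: ndf_.
apply: eq_integral => x _; rewrite -monotone_convergence//.
- by apply: eq_integral => y _; rewrite limE.
- by move=> n; exact: measurable_fun_section (mf_ n).
- by move=> n y _; rewrite lee_fin.
Qed.

End graph_measure.

(** * Square integrable functions *)

Section square_integrable.
Context {d : measure_display} {X : measurableType d} {R : realType}.
Variable nu : {measure set X -> \bar R}.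
Implicit Types f g u v : X -> R.

Lemma L2P f : L2 nu f <->
  measurable_fun setT f /\ rintegrable nu (fun x => f x ^+ 2).
Proof.
split=> -[mf f2]; split=> //.
  apply: rintegrable_ge0 => [|x|]; [exact: measurable_funX|exact: sqr_ge0|].
  by under eq_integral do rewrite -real_normK ?num_real//.
by have := rintegrable_lty f2; under eq_integral do rewrite -real_normK ?num_real//.
Qed.

Lemma L2_measurable f : L2 nu f -> measurable_fun setT f. Proof. by case. Qed.

Lemma L2_le f g : measurable_fun setT f -> rintegrable nu g ->
  (forall x, f x ^+ 2 <= g x) -> L2 nu f.
Proof.
move=> mf ig fg; apply/L2P; split=> //; apply: rintegrable_le ig _ => [|x].
  exact: measurable_funX.
by rewrite ger0_norm ?sqr_ge0.
Qed.

Lemma L2_norm_le f g : measurable_fun setT f -> L2 nu g ->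
  (forall x, `|f x| <= `|g x|) -> L2 nu f.
Proof.
move=> mf /L2P[mg g2] fg; apply: L2_le mf g2 _ => x.
by rewrite -real_normK ?num_real// -[leRHS]real_normK ?num_real// lerXn2r ?nnegrE.
Qed.

Lemma L2D f g : L2 nu f -> L2 nu g -> L2 nu (fun x => f x + g x).
Proof.
move=> /L2P[mf f2] /L2P[mg g2].
apply: (L2_le (measurable_funD mf mg) (rintegrableZ 2 (rintegrableD f2 g2))).
by move=> x /=; have := sqr_ge0 (f x - g x); nra.
Qed.

Lemma L2Z k f : L2 nu f -> L2 nu (fun x => k * f x).
Proof.
move=> /L2P[mf f2]; apply: (L2_le _ (rintegrableZ (k ^+ 2) f2)).
  exact: measurable_funM.
by move=> x; rewrite exprMn.
Qed.

Lemma L2N f : L2 nu f -> L2 nu (fun x => - f x).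
Proof. by move=> /(L2Z (-1)); under eq_fun do rewrite mulN1r. Qed.

Lemma L2B f g : L2 nu f -> L2 nu g -> L2 nu (fun x => f x - g x).
Proof. by move=> f2 /L2N; exact: L2D. Qed.

Lemma L2_mul f g : L2 nu f -> L2 nu g -> rintegrable nu (fun x => f x * g x).
Proof.
move=> /L2P[mf f2] /L2P[mg g2].
apply: rintegrable_le (rintegrableD f2 g2) _; first exact: measurable_funM.
move=> x; rewrite ler_norml; apply/andP; split;
  by have := sqr_ge0 (f x - g x); have := sqr_ge0 (f x + g x); nra.
Qed.

Lemma L2_ae_eq f g : measurable_fun setT g ->
  {ae nu, forall x, f x = g x} -> L2 nu f -> L2 nu g.
Proof.
move=> mg fg /L2P[mf f2]; apply/L2P; split=> //.
apply: rintegrable_ae_eq f2; first exact: measurable_funX.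
by move: fg; apply: filterS => x ->.
Qed.

Lemma L2_clamp c f : 0 <= c -> L2 nu f -> L2 nu (fun x => clamp c (f x)).
Proof.
move=> c0 f2; apply: L2_norm_le (f2) _.
  exact: measurableT_comp (measurable_clamp c) (L2_measurable f2).
by move=> x; exact: clamp_norm_le.
Qed.

Lemma L2_indic E : measurable E -> (nu E < +oo)%E -> L2 nu (\1_E).
Proof.
move=> mE Ey; split; first exact: measurable_indic.
rewrite (_ : (fun x => _) = (fun x => (\1_E x)%:E)); last first.
  by apply/funext => x; rewrite indicE; case: (_ \in _); rewrite ?normr1 ?normr0 ?expr1n ?expr0n.
by rewrite integral_indic// setIT.
Qed.

End square_integrable.

(** * Reversibility, partial integrals and integration by parts *)

Section walk.
Context {d : measure_display} {X : measurableType d} {R : realType}.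
Variables (nu : {measure set X -> \bar R}) (m : X -> probability X R).
Hypotheses (hm : kernel_measurable m) (hrev : nu_reversible nu m).
Implicit Types (u v h : X -> R) (g : X * X -> R).

Let M : {measure set (X * X) -> \bar R} := nuxm_measure nu hm.
Let sw (z : X * X) : X * X := (z.2, z.1).

Let measurable_sw : measurable_fun setT sw.
Proof. by apply/measurable_fun_pairP; split; [exact: measurable_snd|exact: measurable_fst]. Qed.

Let pushforward_sw (C : set (X * X)) : measurable C -> M C = pushforward M sw C.
Proof. by move=> mC; exact: hrev. Qed.

Lemma nuxm_rintegrable_swap g : rintegrable M g ->
  rintegrable M (fun z => g (z.2, z.1)).
Proof.
move=> gi; have mg := rintegrable_measurable gi.
have mgs : measurable_fun setT (g \o sw) by exact: measurableT_comp.
apply/integrableP; split; first exact/measurable_EFinP.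
have /integrableP[_] := gi; congr (_ < _)%E.
rewrite (eq_measure_integral (pushforward M sw)); last first.
  by move=> C mC _; exact: pushforward_sw.
rewrite ge0_integral_pushforward//.
by apply: (@measurableT_comp _ _ _ _ _ _ abse) => //; exact/measurable_EFinP.
Qed.

Lemma nuxm_rintegral_swap g : rintegrable M g ->
  \int[M]_z g (z.2, z.1) = \int[M]_z g z.
Proof.
move=> gi; have mg := rintegrable_measurable gi; congr fine.
rewrite [RHS](eq_measure_integral (pushforward M sw)); last first.
  by move=> C mC _; exact: pushforward_sw.
rewrite (integral_pushforward measurable_sw)//; first exact/measurable_EFinP.
exact: (nuxm_rintegrable_swap gi).
Qed.

Lemma integral_probability_cst x (c : \bar R) : (0 <= c)%E -> (\int[m x]_y c = c)%E.
Proof.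
move=> c0; transitivity (c * m x setT)%E; first exact: integral_cst.
by rewrite probability_setT mule1.
Qed.

Lemma nuxm_rintegrable_fst h : rintegrable nu h -> rintegrable M (fun z => h z.1).
Proof.
move=> hi; have mh := rintegrable_measurable hi.
have mh1 : measurable_fun setT (EFin \o (fun z : X * X => h z.1)).
  by apply/measurable_EFinP; exact: measurableT_comp measurable_fst.
apply/integrableP; split=> //.
rewrite ge0_integral_nuxm//; last exact: measurableT_comp.
have /integrableP[_] := hi; congr (_ < _)%E.
by apply: eq_integral => x _ /=; rewrite integral_probability_cst.
Qed.

Lemma nuxm_rintegrable_snd h : rintegrable nu h -> rintegrable M (fun z => h z.2).
Proof. by move=> /nuxm_rintegrable_fst/nuxm_rintegrable_swap. Qed.

(** The real integral returns [0] where the extended one is infinite, so [kint g] is a total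
    measurable function before any integrability of [g] is known. For an [M]-integrable [g] this
    convention matters on a null set only. *)
Definition kint g (x : X) : R := \int[m x]_y g (x, y).

Section kint.
Variable g : X * X -> R.
Hypothesis mg : measurable_fun setT g.
Let Eg : X * X -> \bar R := EFin \o g.
Let mEg : measurable_fun setT Eg. Proof. exact/measurable_EFinP. Qed.
Let P x : \bar R := (\int[m x]_y (Eg^\+ (x, y)))%E.
Let N x : \bar R := (\int[m x]_y (Eg^\- (x, y)))%E.
Let mP : measurable_fun setT P.
Proof.
by apply: (measurable_kernel_integral hm) => //; exact: measurable_funepos.
Qed.
Let mN : measurable_fun setT N.
Proof.
by apply: (measurable_kernel_integral hm) => //; exact: measurable_funeneg.
Qed.
Let kintE x : (\int[m x]_y (g (x, y))%:E)%E = (P x - N x)%E.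
Proof.
rewrite integralE; congr (_ - _)%E; apply: eq_integral => y _.
  by rewrite !funeposE.
by rewrite !funenegE.
Qed.

Lemma measurable_kint : measurable_fun setT (kint g).
Proof.
rewrite /kint /Rintegral; apply: measurableT_comp; first exact: fine_measurable.
by under eq_fun do rewrite kintE; exact: emeasurable_funB.
Qed.

Hypothesis gi : rintegrable M g.

Let Pi : nu.-integrable setT P.
Proof.
apply/integrableP; split=> //.
have /integrableP[_] := integrable_funepos measurableT gi.
rewrite ge0_integral_nuxm//; last first.
  by apply: measurableT_comp => //; exact: measurable_funepos.
congr (_ < _)%E; apply: eq_integral => x _.
rewrite gee0_abs; last by apply: integral_ge0.
by apply: eq_integral => y _; rewrite gee0_abs.
Qed.

Let Ni : nu.-integrable setT N.
Proof.
apply/integrableP; split=> //.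
have /integrableP[_] := integrable_funeneg measurableT gi.
rewrite ge0_integral_nuxm//; last first.
  by apply: measurableT_comp => //; exact: measurable_funeneg.
congr (_ < _)%E; apply: eq_integral => x _.
rewrite gee0_abs; last by apply: integral_ge0.
by apply: eq_integral => y _; rewrite gee0_abs.
Qed.

Let kint_ae : {ae nu, forall x, setT x -> (P x - N x)%E = (kint g x)%:E}.
Proof.
apply: filterS2 (integrable_ae measurableT Pi) (integrable_ae measurableT Ni).
move=> x /(_ I) Px /(_ I) Nx _; rewrite /kint /Rintegral kintE fineK//.
by rewrite fin_numB Px.
Qed.

Lemma kint_rintegrable : rintegrable nu (kint g).
Proof.
apply/integrableP; split; first exact/measurable_EFinP/measurable_kint.
have /integrableP[_] := integrableB measurableT Pi Ni; congr (_ < _)%E.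
apply: ge0_ae_eq_integral => //.
- by apply: measurableT_comp => //; exact: emeasurable_funB.
- by apply: measurableT_comp => //; exact/measurable_EFinP/measurable_kint.
- by move: kint_ae; apply: filterS => x /(_ I) /= ->.
Qed.

Lemma kint_rintegral : \int[nu]_x kint g x = \int[M]_z g z.
Proof.
congr fine; transitivity (\int[nu]_x (P \- N)%E x)%E.
  apply/esym/ae_eq_integral => //; first exact: emeasurable_funB.
  exact/measurable_EFinP/measurable_kint.
rewrite integralB// [RHS]integralE; congr (_ - _)%E.
- by rewrite ge0_integral_nuxm//; exact: measurable_funepos.
- by rewrite ge0_integral_nuxm//; exact: measurable_funeneg.
Qed.

Lemma ae_rintegrable_section :
  {ae nu, forall x, rintegrable (m x) (fun y => g (x, y))}.
Proof.
apply: filterS2 (integrable_ae measurableT Pi) (integrable_ae measurableT Ni).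
move=> x /(_ I) Px /(_ I) Nx.
apply/integrableP; split.
  by apply/measurable_EFinP; exact: measurable_fun_section mg.
apply/abse_integralP => //.
  by apply/measurable_EFinP; exact: measurable_fun_section mg.
by rewrite -fin_num_abs /= kintE fin_numB Px.
Qed.

End kint.

Lemma nuxm_rintegral_fst h : rintegrable nu h ->
  \int[M]_z h z.1 = \int[nu]_x h x.
Proof.
move=> hi; have hi1 := nuxm_rintegrable_fst hi.
rewrite -(kint_rintegral (rintegrable_measurable hi1) hi1).
apply: eq_Rintegral => x _; transitivity (h x * fine (m x setT)).
  exact: (Rintegral_cst (m x) measurableT (h x)).
by rewrite probability_setT mulr1.
Qed.

Lemma nuxm_rintegral_snd h : rintegrable nu h ->
  \int[M]_z h z.2 = \int[nu]_x h x.
Proof.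
move=> hi; rewrite -nuxm_rintegral_fst//.
exact: (nuxm_rintegral_swap (nuxm_rintegrable_fst hi)).
Qed.

Section integration_by_parts.
Variables (g : X * X -> R) (h : X -> R).
Hypothesis mg : measurable_fun setT g.
Hypothesis g_anti : forall z, g (z.2, z.1) = - g z.
Hypothesis ghi : rintegrable M (fun z => g z * h z.1).

Lemma rintegrable_snd_antisym : rintegrable M (fun z => g z * h z.2).
Proof.
have := rintegrableN (nuxm_rintegrable_swap ghi).
by under eq_fun do rewrite g_anti mulNr opprK.
Qed.

Lemma rintegrable_grad_antisym : rintegrable M (fun z => g z * grad h z).
Proof.
have := rintegrableB rintegrable_snd_antisym ghi.
by under eq_fun do rewrite -mulrBr.
Qed.

(** By [rintegralZ_total] this holds at every [x], even where the section of [g] is not integrable;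
    so integrability of the product [g z * h z.1] is enough below. *)
Let kint_mull : (fun x => kint g x * h x) = kint (fun z => g z * h z.1).
Proof.
apply/funext => x; rewrite /kint mulrC -rintegralZ_total//.
  by apply: eq_Rintegral => y _; rewrite mulrC.
exact: measurable_fun_section mg.
Qed.

Lemma rintegrable_kint_mul : rintegrable nu (fun x => kint g x * h x).
Proof.
rewrite kint_mull; apply: kint_rintegrable ghi.
exact: rintegrable_measurable ghi.
Qed.

(** The swap exchanges [h z.1] with [h z.2] and changes the sign of [g], so the two halves of
    [grad h] contribute equally; this is the factor [2]. *)
Lemma integration_by_parts :
  \int[M]_z (g z * grad h z) = - 2 * \int[nu]_x (kint g x * h x).
Proof.
have -> : \int[nu]_x (kint g x * h x) = \int[M]_z (g z * h z.1).
  rewrite kint_mull; apply: kint_rintegral ghi.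
  exact: rintegrable_measurable ghi.
under eq_Rintegral do rewrite /grad mulrBr.
rewrite (rintegralB rintegrable_snd_antisym ghi).
have := nuxm_rintegral_swap ghi.
under eq_Rintegral do rewrite g_anti mulNr.
by rewrite (rintegralN rintegrable_snd_antisym); lra.
Qed.

End integration_by_parts.

End walk.

(** * Energies *)

Section scalar_bounds.
Context {R : realType}.
Implicit Types (p t c : R).

Lemma mul_le_sqr (a b : R) : 0 <= a -> 0 <= b -> a * b <= a ^+ 2 + b ^+ 2.
Proof. by move=> a0 b0; have := sqr_ge0 (a - b); nra. Qed.

Lemma powR_le_sqr p c t : 2 <= p -> `|t| <= c ->
  `|t| `^ p <= c `^ (p - 2) * t ^+ 2.
Proof.
move=> p2 tc; have c0 : 0 <= c by exact: le_trans tc.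
have -> : `|t| `^ p = `|t| `^ (p - 2) * t ^+ 2.
  rewrite -real_normK ?num_real// -powR_mulrn// -powRD ?subrK//.
  by apply/implyP => /eqP; lra.
apply: ler_wpM2r; first exact: sqr_ge0.
by apply: ge0_ler_powR => //; rewrite ?nnegrE ?subr_ge0.
Qed.

Lemma powRB1_le p t : 1 < p -> `|t| `^ (p - 1) <= 1 + `|t| `^ p.
Proof.
move=> p1; have [t1|/ltW t1] := leP `|t| 1.
  rewrite (@le_trans _ _ 1) ?lerDl ?powR_ge0//.
  rewrite (le_trans (ge0_ler_powR _ _ _ t1)) ?powR1 ?nnegrE//; lra.
by rewrite (@le_trans _ _ (`|t| `^ p)) ?lerDr// ler_powR//; lra.
Qed.

(** Over an infinite measure the constant [1] of [powRB1_le] is not integrable. It is replaced by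
    [|t|], which is square integrable along gradients; near [0] this uses [p - 1 >= 1]. *)
Lemma powRB1_le_linear p t : 2 <= p -> `|t| `^ (p - 1) <= `|t| + `|t| `^ p.
Proof.
move=> p2; have [t1|/ltW t1] := leP `|t| 1; last first.
  by rewrite (@le_trans _ _ (`|t| `^ p)) ?lerDr// ler_powR//; lra.
rewrite (@le_trans _ _ `|t|) ?lerDl ?powR_ge0//.
have [->|t0] := eqVneq t 0; first by rewrite normr0 powR0//; apply/eqP; lra.
by rewrite ge1r_powR//; [rewrite normr_gt0 t0|lra].
Qed.

End scalar_bounds.

(** Jensen's inequality for the square: integrate [2 c |f| <= f^2 + c^2] with [c] the mean of
    [|f|]. *)
Lemma probability_sqr_le {d : measure_display} {T : measurableType d} {R : realType}
    (P : probability T R) (f : T -> R) :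
  measurable_fun setT f -> rintegrable P (fun x => f x ^+ 2) ->
  rintegrable P (fun x => `|f x|) /\
  (\int[P]_x `|f x|) ^+ 2 <= \int[P]_x (f x ^+ 2).
Proof.
move=> mf f2; have ci (c : R) : rintegrable P (fun=> c).
  apply/integrableP; split; first exact/measurable_EFinP.
  by rewrite /= integral_cst//= lte_mul_pinfty// probability_setT ltry.
have PE (c : R) : \int[P]_x c = c.
  transitivity (c * fine (P setT)); first exact: Rintegral_cst.
  by rewrite probability_setT mulr1.
have fi : rintegrable P (fun x => `|f x|).
  apply: rintegrable_le (rintegrableD (ci 1) f2) _; first exact: measurableT_comp.
  move=> x; rewrite normr_id -real_normK ?num_real//.
  by have := sqr_ge0 (`|f x| - 2^-1); nra.
split=> //; set c := \int[P]_x _.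
have : \int[P]_x (2 * c * `|f x|) <= \int[P]_x (f x ^+ 2 + c ^+ 2).
  apply: le_rintegral; [exact: rintegrableZ|exact: rintegrableD|].
  move=> x; rewrite -[X in _ <= X + _]real_normK ?num_real//.
  by have := sqr_ge0 (`|f x| - c); nra.
by rewrite rintegralZ// rintegralD// PE -/c; nra.
Qed.

(** Average the subgradient inequalities at the intermediate point [r]: the linear terms cancel. *)
Lemma subgradient_convex {R : realType} (phi psi : R -> R) (k : R) :
  (forall s t, phi t + k * (psi t * (s - t)) <= phi s) ->
  forall s t th, 0 <= th <= 1 ->
    phi ((1 - th) * s + th * t) <= (1 - th) * phi s + th * phi t.
Proof.
move=> sub s t th /andP[th0 th1]; set r := _ + _.
have h1 : 0 <= 1 - th by rewrite subr_ge0.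
have := ler_wpM2l h1 (sub s r); have := ler_wpM2l th0 (sub t r).
have e : (1 - th) * (k * (psi r * (s - r))) + th * (k * (psi r * (t - r))) = 0.
  by rewrite /r; ring.
by rewrite !mulrDr; lra.
Qed.

Section conductance.
Context {d : measure_display} {X : measurableType d} {R : realType}.
Variable A : X -> set X.

Lemma Kset_ge0 z : 0 <= Kset A z :> R.
Proof. by rewrite /Kset mulr_ge0// addr_ge0. Qed.

Lemma Kset_le1 z : Kset A z <= 1 :> R.
Proof.
have h (S : set X) x : \1_S x <= 1 :> R by rewrite indicE; case: (_ \in _).
by rewrite /Kset; have := h (A z.1) z.2; have := h (A z.2) z.1; lra.
Qed.

Lemma Kset_sym z : Kset A (z.2, z.1) = Kset A z :> R.
Proof. by rewrite /Kset /= addrC. Qed.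

Lemma measurable_Kset : measurable [set z : X * X | A z.1 z.2] ->
  measurable_fun setT (Kset A : X * X -> R).
Proof.
move=> mA; apply: measurable_funM => //.
set C := [set z : X * X | A z.1 z.2] in mA.
have mC : measurable_fun setT (\1_C : X * X -> R) by exact: measurable_indic.
apply: measurable_funD; first exact: mC.
apply: (measurableT_comp mC (g := fun z : X * X => (z.2, z.1))).
by apply/measurable_fun_pairP; split; [exact: measurable_snd|exact: measurable_fst].
Qed.

End conductance.

Section energy.
Context {d : measure_display} {X : measurableType d} {R : realType}.
Variables (nu : {measure set X -> \bar R}) (m : X -> probability X R).
Hypotheses (hm : kernel_measurable m) (hrev : nu_reversible nu m).
Implicit Types (u v w h : X -> R) (phi psi : R -> R) (K : X * X -> R).

Local Notation M := (nuxm_measure nu hm).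

Definition energy phi K u : \bar R :=
  nuxm nu m (fun z => (phi (grad u z) * K z)%:E).

Lemma measurable_grad u : measurable_fun setT u -> measurable_fun setT (grad u).
Proof.
move=> mu; apply: measurable_funB.
  exact: measurableT_comp measurable_snd.
exact: measurableT_comp measurable_fst.
Qed.

Section energy_theory.
Variables (phi : R -> R) (K : X * X -> R).
Hypotheses (mphi : measurable_fun setT phi) (phi0 : forall t, 0 <= phi t).
Hypotheses (mK : measurable_fun setT K) (K0 : forall z, 0 <= K z).

Lemma measurable_density u : measurable_fun setT u ->
  measurable_fun setT (fun z => phi (grad u z) * K z).
Proof.
move=> mu; apply: measurable_funM => //.
exact: measurableT_comp (measurable_grad mu).
Qed.

Lemma energyE u : measurable_fun setT u ->
  energy phi K u = (\int[M]_z (phi (grad u z) * K z)%:E)%E.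
Proof.
move=> mu; apply/esym/ge0_integral_nuxm.
  by move=> z; rewrite lee_fin mulr_ge0.
by apply/measurable_EFinP; exact: measurable_density.
Qed.

Lemma energy_ltyP u : measurable_fun setT u ->
  (energy phi K u < +oo)%E <-> rintegrable M (fun z => phi (grad u z) * K z).
Proof.
move=> mu; rewrite energyE//; split; last exact: rintegrable_lty.
apply: rintegrable_ge0; first exact: measurable_density.
by move=> z; rewrite mulr_ge0.
Qed.

Lemma energy_fin u : measurable_fun setT u ->
  rintegrable M (fun z => phi (grad u z) * K z) ->
  energy phi K u = (\int[M]_z (phi (grad u z) * K z))%:E.
Proof. by move=> mu ui; rewrite energyE// rintegralE. Qed.

Lemma energy_ge0 u : (0 <= energy phi K u)%E.
Proof.
by apply: integral_ge0 => x _; apply: integral_ge0 => y _; rewrite lee_fin mulr_ge0.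
Qed.

Lemma cenergy_ltyP c u : 0 < c -> measurable_fun setT u ->
  (c%:E * energy phi K u < +oo)%E <->
  rintegrable M (fun z => phi (grad u z) * K z).
Proof.
move=> c0 mu; rewrite -energy_ltyP//; split=> [|uy]; last first.
  by apply: lte_mul_pinfty => //; rewrite lee_fin ltW.
by rewrite !ltey; apply: contra => /eqP ->; rewrite gt0_muley ?lte_fin.
Qed.

(* With [2 c k = 1], the weak form [2^-1 \int psi (grad u) K grad (w - u)] is
   the derivative of [c energy] at [u] in the direction [w - u]. *)
Lemma subdiff_energy psi (c k : R) u v :
  0 < c -> c * k = 2^-1 ->
  (forall s t, phi t + k * (psi t * (s - t)) <= phi s) ->
  L2 nu u -> L2 nu v -> rintegrable M (fun z => phi (grad u z) * K z) ->
  (forall w, L2 nu w -> rintegrable M (fun z => phi (grad w z) * K z) ->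
    rintegrable M (fun z => psi (grad u z) * K z * grad (fun x => w x - u x) z) /\
    2^-1 * \int[M]_z (psi (grad u z) * K z * grad (fun x => w x - u x) z) =
    \int[nu]_x (v x * (w x - u x))) ->
  subdiff nu (fun u => c%:E * energy phi K u)%E u v.
Proof.
move=> c0 ck sub u2 v2 ui H; have mu := L2_measurable u2.
split=> //; split=> //; split; first exact/cenergy_ltyP.
move=> w w2; have mw := L2_measurable w2.
have [wi|wy] := pselect (rintegrable M (fun z => phi (grad w z) * K z)); last first.
  have : ~ (c%:E * energy phi K w < +oo)%E by move=> /cenergy_ltyP -/(_ c0 mw).
  by rewrite ltey => /negP; rewrite negbK => /eqP ->; exact: leey.
have [gi gE] := H _ w2 wi.
rewrite !energy_fin// (rintegralE (L2_mul v2 (L2B w2 u2))) -gE lee_fin.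
rewrite -ck -mulrA -mulrDr ler_pM2l// -rintegralZ// -rintegralD//; last exact: rintegrableZ.
apply: le_rintegral => //; first by apply: rintegrableD => //; exact: rintegrableZ.
move=> z; apply: le_trans (ler_wpM2r (K0 z) (sub (grad w z) (grad u z))).
by rewrite le_eqVlt; apply/orP; left; apply/eqP; rewrite /grad; ring.
Qed.

(** The increment of [T (u1 - u2)] along an edge is [th] times that of [u1 - u2]. Hence [grad w1]
    and [grad w2] are the convex combinations of [grad u1] and [grad u2] with weights [1 - th, th]
    and [th, 1 - th]; as [th] is the same in both, the two convexity inequalities add up to the
    claim. *)
Lemma energy_exchange (T : R -> R) u1 u2 :
  (forall s t th, 0 <= th <= 1 ->
    phi ((1 - th) * s + th * t) <= (1 - th) * phi s + th * phi t) ->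
  measurable_fun setT T ->
  (forall s t, exists2 th, 0 <= th <= 1 & T s - T t = th * (s - t)) ->
  measurable_fun setT u1 -> measurable_fun setT u2 ->
  rintegrable M (fun z => phi (grad u1 z) * K z) ->
  rintegrable M (fun z => phi (grad u2 z) * K z) ->
  let w1 x := u1 x - T (u1 x - u2 x) in let w2 x := u2 x + T (u1 x - u2 x) in
  [/\ rintegrable M (fun z => phi (grad w1 z) * K z),
      rintegrable M (fun z => phi (grad w2 z) * K z) &
      \int[M]_z (phi (grad w1 z) * K z) + \int[M]_z (phi (grad w2 z) * K z) <=
      \int[M]_z (phi (grad u1 z) * K z) + \int[M]_z (phi (grad u2 z) * K z)].
Proof.
move=> cvx mT Tb mu1 mu2 i1 i2 w1 w2.
have mTu : measurable_fun setT (fun x => T (u1 x - u2 x)).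
  by apply: measurableT_comp => //; exact: measurable_funB.
have mw1 : measurable_fun setT w1 by exact: measurable_funB.
have mw2 : measurable_fun setT w2 by exact: measurable_funD.
have le z : phi (grad w1 z) + phi (grad w2 z) <= phi (grad u1 z) + phi (grad u2 z).
  have [th th01 e] := Tb (u1 z.2 - u2 z.2) (u1 z.1 - u2 z.1).
  have -> : grad w1 z = (1 - th) * grad u1 z + th * grad u2 z.
    rewrite /w1 /grad (_ : forall a b c d : R, (a - b) - (c - d) = a - c - (b - d)).
      by rewrite e; ring.
    by move=> a b c' d'; ring.
  have -> : grad w2 z = (1 - th) * grad u2 z + th * grad u1 z.
    rewrite /w2 /grad (_ : forall a b c d : R, (a + b) - (c + d) = a - c + (b - d)).
      by rewrite e; ring.
    by move=> a b c' d'; ring.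
  by have := cvx (grad u1 z) (grad u2 z) th th01;
    have := cvx (grad u2 z) (grad u1 z) th th01; lra.
have lek z : phi (grad w1 z) * K z + phi (grad w2 z) * K z <=
    phi (grad u1 z) * K z + phi (grad u2 z) * K z.
  by rewrite -!mulrDl ler_wpM2r.
have j1 : rintegrable M (fun z => phi (grad w1 z) * K z).
  apply: rintegrable_le (rintegrableD i1 i2) _; first exact: measurable_density.
  move=> z; rewrite ger0_norm ?mulr_ge0//; apply: le_trans (lek z).
  by rewrite lerDl mulr_ge0.
have j2 : rintegrable M (fun z => phi (grad w2 z) * K z).
  apply: rintegrable_le (rintegrableD i1 i2) _; first exact: measurable_density.
  move=> z; rewrite ger0_norm ?mulr_ge0//; apply: le_trans (lek z).
  by rewrite lerDr mulr_ge0.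
split=> //; rewrite -!rintegralD//.
by apply: le_rintegral => //; exact: rintegrableD.
Qed.

End energy_theory.

Lemma L2_grad u : L2 nu u -> rintegrable M (fun z => grad u z ^+ 2).
Proof.
move=> /L2P[mu u2].
have i := rintegrableZ 2 (rintegrableD
  (nuxm_rintegrable_fst hm u2) (nuxm_rintegrable_snd hm hrev u2)).
apply: rintegrable_le i _.
  by apply: measurable_funX; exact: measurable_grad.
move=> z; rewrite ger0_norm ?sqr_ge0// /grad.
by have := sqr_ge0 (u z.1 + u z.2); nra.
Qed.

(** * The p-energy, its flux and its subgradient *)

Section p_energy.
Variables (K : X * X -> R) (p : R).
Hypotheses (mK : measurable_fun setT K) (K0 : forall z, 0 <= K z).
Hypotheses (K1 : forall z, K z <= 1) (Ksym : forall z, K (z.2, z.1) = K z).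
Hypothesis p1 : 1 < p.
Hypothesis fin_or_p2 : (nu setT < +oo)%E \/ 2 <= p.

Local Notation pw := (fun t : R => `|t| `^ p).

Definition pfin u := rintegrable M (fun z => `|grad u z| `^ p * K z).
Definition pflux u z := psi p (grad u z) * K z.

Lemma measurable_pow : measurable_fun setT pw.
Proof.
apply: (measurableT_comp (f := @powR R ^~ p) (g := fun t : R => `|t|)).
  exact: measurable_powR.
exact: normr_measurable.
Qed.

Lemma measurable_pflux u : measurable_fun setT u -> measurable_fun setT (pflux u).
Proof.
move=> mu; apply: measurable_funM => //.
exact: measurableT_comp (measurable_psi p1) (measurable_grad mu).
Qed.

Lemma pflux_antisym u z : pflux u (z.2, z.1) = - pflux u z.
Proof. by rewrite /pflux Ksym -mulNr -psiN /grad opprB. Qed.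

Lemma rintegrable_cst : (nu setT < +oo)%E -> forall c : R, rintegrable M (fun=> c).
Proof.
move=> nuy c; apply: (nuxm_rintegrable_fst hm (h := fun=> c)).
apply/integrableP; split; first exact/measurable_EFinP.
by rewrite /= integral_cst//= lte_mul_pinfty.
Qed.

Lemma pfinD u h t : measurable_fun setT u -> measurable_fun setT h ->
  `|t| <= 1 -> pfin u -> pfin h -> pfin (fun x => u x + t * h x).
Proof.
move=> mu mh t1 ui hi.
apply: (rintegrable_le _ (rintegrableZ (2 `^ p) (rintegrableD ui hi))).
  apply: (measurable_density (phi := pw) measurable_pow mK).
  by apply: measurable_funD => //; exact: measurable_funM.
move=> z; rewrite ger0_norm ?mulr_ge0 ?powR_ge0// -mulrDl mulrA ler_wpM2r//.
have -> : grad (fun x => u x + t * h x) z = grad u z + t * grad h z.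
  by rewrite /grad; ring.
apply: le_trans (powR_add_le p1 _ _) _; rewrite ler_wpM2l ?powR_ge0// lerD2l.
by apply: powR_le_norm => //; rewrite normrM ler_piMl.
Qed.

(** For finite [nu] the density is dominated by the constant [(2 c)^p]. For [p >= 2] boundedness
    lowers the exponent to [2]: the density is at most [(2 c)^(p-2)] times the integrable
    [(grad h)^2]. *)
Lemma pfin_bounded h (c : R) : L2 nu h -> (forall x, `|h x| <= c) -> pfin h.
Proof.
move=> h2 hc; have mh := L2_measurable h2.
have gc z : `|grad h z| <= 2 * c.
  by rewrite (le_trans (ler_normB _ _))//; have := hc z.1; have := hc z.2; lra.
have md : measurable_fun setT (fun z => `|grad h z| `^ p * K z).
  exact: (measurable_density (phi := pw) measurable_pow mK mh).
have le1 z : `| `|grad h z| `^ p * K z| <= `|grad h z| `^ p.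
  by rewrite ger0_norm ?mulr_ge0 ?powR_ge0// ler_piMr ?powR_ge0.
case: fin_or_p2 => [nuy|p2].
  apply: rintegrable_le md (rintegrable_cst nuy ((2 * c) `^ p)) _ => z.
  have p0 : 0 <= p by exact: ltW (lt_trans ltr01 p1).
  have c0 : 0 <= 2 * c by exact: (le_trans (normr_ge0 _) (gc z)).
  by rewrite (le_trans (le1 z))//; apply: ge0_ler_powR.
apply: rintegrable_le md (rintegrableZ ((2 * c) `^ (p - 2)) (L2_grad h2)) _ => z.
by rewrite (le_trans (le1 z))// powR_le_sqr.
Qed.

(** The flux grows like the power [p - 1]. For finite [nu], [1 + |grad u|^p K] absorbs it; for
    [p >= 2], the linear part pairs with [h] as a product of square integrable functions, and only
    the part [|grad u|^p K] uses the bound [c]. *)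
Lemma pflux_bounded u h (c : R) : L2 nu u -> pfin u -> L2 nu h ->
  (forall x, `|h x| <= c) -> rintegrable M (fun z => pflux u z * h z.1).
Proof.
move=> u2 ui h2 hc; have mu := L2_measurable u2; have mh := L2_measurable h2.
have mg : measurable_fun setT (fun z => pflux u z * h z.1).
  apply: measurable_funM; first exact: measurable_pflux.
  exact: measurableT_comp measurable_fst.
have nE z : `|pflux u z * h z.1| = `|grad u z| `^ (p - 1) * K z * `|h z.1|.
  rewrite normrM /pflux (normrM (psi p (grad u z))) norm_psi//.
  by rewrite (ger0_norm (K0 z)).
case: fin_or_p2 => [nuy|p2].
  apply: rintegrable_le mg (rintegrableZ c (rintegrableD (rintegrable_cst nuy 1) ui)) _.
  move=> z; rewrite nE mulrC; apply: ler_pM => //.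
    by rewrite mulr_ge0 ?powR_ge0.
  apply: le_trans (ler_wpM2r (K0 z) (powRB1_le _ p1)) _.
  by rewrite mulrDl mul1r lerD2r.
have /L2P[_ h2'] := h2.
apply: rintegrable_le mg (rintegrableD (rintegrableD (L2_grad u2)
  (nuxm_rintegrable_fst hm h2')) (rintegrableZ c ui)) _ => z.
rewrite nE; apply: (@le_trans _ _
  (`|grad u z| * `|h z.1| + `|grad u z| `^ p * K z * c)).
  apply: le_trans (ler_wpM2r _ (ler_wpM2r (K0 z) (powRB1_le_linear _ p2))) _ => //.
  rewrite mulrDl mulrDl; apply: lerD.
    by rewrite ler_wpM2r// ler_piMr.
  by rewrite ler_wpM2l// mulr_ge0 ?powR_ge0.
rewrite [_ * c]mulrC lerD2r -(real_normK (num_real (grad u z))).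
rewrite -(real_normK (num_real (h z.1))).
exact: mul_le_sqr.
Qed.

Lemma pflux_grad u h : measurable_fun setT u -> measurable_fun setT h ->
  pfin u -> pfin h -> rintegrable M (fun z => pflux u z * grad h z).
Proof.
move=> mu mh ui hi; apply: rintegrable_le (rintegrableD ui hi) _.
  by apply: measurable_funM; [exact: measurable_pflux|exact: measurable_grad].
move=> z; rewrite /pflux mulrAC normrM (ger0_norm (K0 z)) -mulrDl.
by rewrite ler_wpM2r// psi_young.
Qed.

Lemma cvg_grad_clamp h z :
  grad (fun x => clamp n%:R (h x)) z @[n --> \oo] --> grad h z.
Proof. by apply: cvgB; exact: cvg_clamp. Qed.

(* Truncating [h] makes [pflux u z * h z.1] integrable, as integration by parts
   requires; the general case follows by dominated convergence. *)
Lemma pflux_by_parts u h : L2 nu u -> pfin u -> L2 nu (kint m (pflux u)) ->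
  L2 nu h -> pfin h ->
  2^-1 * \int[M]_z (pflux u z * grad h z) = - \int[nu]_x (kint m (pflux u) x * h x).
Proof.
move=> u2 ui D2 h2 hi; have mu := L2_measurable u2; have mh := L2_measurable h2.
pose hn n x := clamp n%:R (h x).
have hn2 n : L2 nu (hn n) by exact: L2_clamp.
have mhn n := L2_measurable (hn2 n).
have mfl := measurable_pflux mu.
have IBP n : 2^-1 * \int[M]_z (pflux u z * grad (hn n) z) =
    - \int[nu]_x (kint m (pflux u) x * hn n x).
  rewrite (integration_by_parts hrev (hm := hm))//.
  - by rewrite mulNr mulrN mulrA mulVf// mul1r.
  - by move=> z; exact: pflux_antisym.
  - by apply: pflux_bounded => // x; exact: clamp_le.
have [_ L] : rintegrable M (fun z => pflux u z * grad h z) /\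
    \int[M]_z (pflux u z * grad (hn n) z) @[n --> \oo] -->
    \int[M]_z (pflux u z * grad h z).
  apply: (rdominated_convergence _ _ (rintegrable_abs (pflux_grad mu mh ui hi))).
  - by move=> n; apply: measurable_funM => //; exact: measurable_grad.
  - by move=> z; apply: cvgM; [exact: cvg_cst|exact: cvg_grad_clamp].
  - by move=> n z; rewrite !normrM ler_wpM2l//; exact: clamp_contract.
have [_ L'] : rintegrable nu (fun x => kint m (pflux u) x * h x) /\
    \int[nu]_x (kint m (pflux u) x * hn n x) @[n --> \oo] -->
    \int[nu]_x (kint m (pflux u) x * h x).
  apply: (rdominated_convergence _ _ (rintegrable_abs (L2_mul D2 h2))).
  - by move=> n; apply: measurable_funM => //; exact: L2_measurable D2.
  - by move=> x; apply: cvgM; [exact: cvg_cst|exact: cvg_clamp].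
  - by move=> n x; rewrite !normrM ler_wpM2l//; exact: clamp_norm_le.
have L1 : 2^-1 * \int[M]_z (pflux u z * grad (hn n) z) @[n --> \oo] -->
    2^-1 * \int[M]_z (pflux u z * grad h z).
  by apply: cvgM; [exact: cvg_cst|exact: L].
have L2 : - (\int[nu]_x (kint m (pflux u) x * hn n x)) @[n --> \oo] -->
    - \int[nu]_x (kint m (pflux u) x * h x).
  exact: cvgN L'.
rewrite (funext IBP) in L1.
exact: (cvg_unique (@Rhausdorff R) L1 L2).
Qed.

Lemma subdiff_pflux u : L2 nu u -> pfin u -> L2 nu (kint m (pflux u)) ->
  subdiff nu (fun u => ((2 * p)^-1)%:E * energy pw K u)%E u
    (fun x => - kint m (pflux u) x).
Proof.
move=> u2 ui D2; have p0 : 0 < p by exact: lt_trans p1.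
apply: (@subdiff_energy _ _ measurable_pow _ mK K0 (psi p) _ p) => //.
- by rewrite invr_gt0 mulr_gt0.
- by rewrite invfM -mulrA mulVf ?mulr1// gt_eqF.
- by move=> s t; exact: psi_subgradient.
- exact: L2N.
move=> w w2 wi; have h2 := L2B w2 u2.
have hi : pfin (fun x => w x - u x).
  have := pfinD (L2_measurable w2) (L2_measurable u2) (t := -1).
  rewrite normrN1 lexx => /(_ isT wi ui).
  by under eq_fun do rewrite mulN1r.
split.
  by apply: (pflux_grad _ _ ui hi); apply: L2_measurable; eassumption.
rewrite (pflux_by_parts u2 ui D2 h2 hi).
have := rintegralN (L2_mul D2 h2).
by under eq_Rintegral do rewrite -mulNr.
Qed.

End p_energy.

End energy.

(** * Moreau envelopes *)

Section moreau.
Context {R : realType}.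
Variable j : R -> \bar R.
Hypothesis hj : admissible_j j.
Implicit Types (a b c s t x y z r : R).

Let j_ge0 t : (0 <= j t)%E. Proof. by case: hj. Qed.
Let j0 : j 0 = 0%E. Proof. by case: hj => _ []. Qed.

Let j_convex x y a b t : 0 < t < 1 -> (j x <= a%:E)%E -> (j y <= b%:E)%E ->
  (j (t * x + (1 - t) * y) <= (t * a + (1 - t) * b)%:E)%E.
Proof.
case: hj => _ [_ [cvx _]] t01 jx jy; apply: le_trans (cvx x y t t01) _.
have /andP[t0 t1] := t01.
rewrite [leRHS](_ : _ = (t%:E * a%:E + (1 - t)%:E * b%:E)%E)//.
by apply: leeD; apply: lee_wpmul2l => //; rewrite lee_fin; lra.
Qed.

Let j_lsc (y_ : nat -> R) y a : y_ n @[n --> \oo] --> y ->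
  (forall e, 0 < e -> \forall n \near \oo, (j (y_ n) <= (a + e)%:E)%E) ->
  (j y <= a%:E)%E.
Proof.
case: hj => _ [_ [_ lsc]] cy H.
apply/lee_addgt0Pr => e e0; rewrite -EFinD.
exact: (@closed_cvg _ _ _ _ y_ _ (lsc (a + e)) (H e e0) y cy).
Qed.

Lemma measurable_admissible : measurable_fun setT j.
Proof.
apply: lower_semicontinuous_measurable; apply/lower_semicontinuousP => a.
case: hj => _ [_ [_ /(_ a)/closed_openC]].
congr open; apply/seteqP; split=> x /=; first by move/negP; rewrite -ltNge.
by move=> h; apply/negP; rewrite -ltNge.
Qed.

(** This is [j y + c / 2 * (x - y)^2 <= r] with the quadratic on the real side: points where [j] is
    infinite are excluded, and the envelope is an infimum of real numbers. *)
Definition penalized c x y r := (j y <= (r - c / 2 * (x - y) ^+ 2)%:E)%E.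

Definition moreau_env c x := inf [set r | exists y, penalized c x y r].

Section fixed_parameter.
Variable c : R.
Hypothesis c0 : 0 < c.

Let cost := penalized c.
Let costs x := [set r | exists y, cost x y r].
Let env := moreau_env c.

Let cost_ge0 x y r : cost x y r -> 0 <= r.
Proof.
move=> h; have := le_trans (j_ge0 y) h; rewrite lee_fin.
by have := mulr_ge0 (ltW c0) (sqr_ge0 (x - y)); lra.
Qed.

Let inf_costs x : has_inf (costs x).
Proof.
split; last by exists 0 => r [y /cost_ge0].
by exists (c / 2 * x ^+ 2); exists 0; rewrite /cost /penalized j0 subr0 subrr.
Qed.

Let env_le x y r : cost x y r -> env x <= r.
Proof. by move=> h; apply: ge_inf; [case: (inf_costs x)|exists y]. Qed.

(** Midpoint convexity of [j] together with the parallelogram identity for the quadratic, whose gain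
    is [c / 8 * (y - z)^2]. *)
Let cost_mid x y z r s : cost x y r -> cost x z s ->
  cost x ((y + z) / 2) ((r + s) / 2 - c / 8 * (y - z) ^+ 2).
Proof.
move=> h1 h2; have t01 : 0 < (2^-1 : R) < 1 by lra.
have := j_convex t01 h1 h2.
rewrite /cost /penalized (_ : 2^-1 * y + _ = (y + z) / 2); last by field.
by move=> h; apply: le_trans h _; rewrite lee_fin le_eqVlt; apply/orP; left;
  apply/eqP; field.
Qed.

(* Strong convexity of the penalised cost makes minimising sequences Cauchy. *)
Let prox_ex x : exists y, cost x y (env x).
Proof.
set i := env x.
have ex (n : nat) : exists y, cost x y (i + n.+1%:R^-1).
  have n0 : 0 < n.+1%:R^-1 :> R by rewrite invr_gt0.
  have [r [y cy] ri] := inf_adherent n0 (inf_costs x).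
  by exists y; apply: le_trans cy _; rewrite lee_fin lerB// ltW.
have {ex} [y_ yP] := choice ex.
have close n k : (n <= k)%N -> c / 8 * (y_ n - y_ k) ^+ 2 <= n.+1%:R^-1.
  move=> nk; have : i <= _ := env_le (cost_mid (yP n) (yP k)).
  have : (k.+1%:R^-1 : R) <= n.+1%:R^-1 by rewrite lef_pV2 ?posrE ?ler_nat.
  by move: (i) (n.+1%:R^-1) (k.+1%:R^-1) => I a b; lra.
have closee n k e : 0 < e -> n.+1%:R^-1 < c / 8 * e ^+ 2 -> (n <= k)%N ->
    `|y_ n - y_ k| < e.
  move=> e0 ne /close; move: (n.+1%:R^-1) ne => w ne h.
  rewrite ltNge; apply/negP => eh.
  have : e ^+ 2 <= `|y_ n - y_ k| ^+ 2 by rewrite lerXn2r ?nnegrE// ltW.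
  have c8 : 0 <= c / 8 by rewrite divr_ge0// ltW.
  by rewrite real_normK ?num_real// => /(ler_wpM2l c8); lra.
have cvg_y : cvgn y_.
  apply/cauchy_cvgP/cauchy_ballP => e e0.
  have h : 0 < c / 8 * e ^+ 2 by rewrite mulr_gt0 ?exprn_gt0// divr_gt0.
  have [N _ HN] := near_infty_natSinv_lt (PosNum h).
  exists (y_ @` [set n | (N <= n)%N], y_ @` [set n | (N <= n)%N]) => /=.
    by split; exists N => // n /= Nn; exists n.
  move=> [_ _] /= [[n /= Nn <-] [k /= Nk <-]]; rewrite /ball /= .
  have [nk|/ltnW kn] := leqP n k; first exact: closee e0 (HN n Nn) nk.
  by rewrite distrC; exact: closee e0 (HN k Nk) kn.
exists (limn y_); apply: (@j_lsc y_) => // e e0.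
have e20 : 0 < e / 2 by rewrite divr_gt0.
have cv : c / 2 * (x - y_ n) ^+ 2 @[n --> \oo] --> c / 2 * (x - limn y_) ^+ 2.
  apply: cvgM; first exact: cvg_cst.
  have xy : x - y_ n @[n --> \oo] --> x - limn y_.
    by apply: cvgB => //; exact: cvg_cst.
  by under eq_fun do rewrite expr2; rewrite expr2; exact: cvgM.
near=> n; apply: le_trans (yP n) _; rewrite lee_fin.
have : c / 2 * (x - limn y_) ^+ 2 - e / 2 < c / 2 * (x - y_ n) ^+ 2.
  by near: n; apply: (cvgr_gt _ cv); rewrite gtrBl.
have : n.+1%:R^-1 < e / 2 by near: n; exact: near_infty_natSinv_lt (PosNum e20).
rewrite -/i; move: (i) (n.+1%:R^-1) (c / 2 * _) (c / 2 * _) => I w s1 s2; lra.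
Unshelve. all: by end_near. Qed.

Definition prox x := sval (cid (prox_ex x)).

(** The value of [j] at [prox x] as a real number, as [jPE] confirms. *)
Let jP x := env x - c / 2 * (x - prox x) ^+ 2.

Let proxP x : (j (prox x) <= (jP x)%:E)%E.
Proof. exact: (svalP (cid (prox_ex x))). Qed.

Let env_leD x y r : (j y <= r%:E)%E -> env x <= r + c / 2 * (x - y) ^+ 2.
Proof. by move=> h; apply: (@env_le x y); rewrite /cost /penalized addrK. Qed.

Let jPE x : j (prox x) = (jP x)%:E.
Proof.
apply/eqP; rewrite eq_le proxP /=.
have := proxP x; have := j_ge0 (prox x).
case E : (j (prox x)) => [r| |]// _ _; rewrite lee_fin /jP lerBlDr.
by apply: env_leD; rewrite E.
Qed.

(** This makes [c * (x - prox x)] a subgradient of [j] at [prox x]: compare the minimiser with the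
    point [t * y + (1 - t) * prox x] of the segment, divide by [t], and let the quadratic remainder
    become negligible. *)
Let prox_variational x y r : (j y <= r%:E)%E ->
  jP x + c * (x - prox x) * (y - prox x) <= r.
Proof.
move=> jy; apply/ler_addgt0Pr => e e0.
set D := (y - prox x) ^+ 2; have D0 : 0 <= D by exact: sqr_ge0.
(* The bound [2^-1] keeps [t] below [1]; the other one makes the remainder [t * c * D / 2] at most
   [e], and [D + 1] keeps the denominator positive when [D = 0]. *)
pose t := Num.min (2^-1) (e / (c * (D + 1))).
have w0 : 0 < c * (D + 1) by rewrite mulr_gt0// ltr_wpDl.
have t0 : 0 < t by rewrite lt_min invr_gt0 divr_gt0// ltr0n.
have t1 : t < 1 by rewrite gt_min (_ : 2^-1 < 1 = true)//; lra.
have te : t * (c * D) <= e.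
  have h : t * (c * (D + 1)) <= e by rewrite -ler_pdivlMr// ge_min lexx orbT.
  by apply: le_trans h; rewrite ler_pM2l// ler_pM2l// lerDl.
have := env_leD x (j_convex (introT andP (conj t0 t1)) jy (proxP x)).
have -> : env x = jP x + c / 2 * (x - prox x) ^+ 2 by rewrite /jP subrK.
move: (jP x) => J; rewrite /D in te.
clearbody t; clear D D0 w0.
move: (prox x) te => P te h.
rewrite -(ler_pM2l t0).
have : t * (t * (c * (y - P) ^+ 2)) <= t * e by rewrite ler_pM2l.
have : 0 <= t * (t * (c * (y - P) ^+ 2)).
  by do 3 (apply: mulr_ge0; first exact: ltW); exact: sqr_ge0.
nra.
Qed.

(** Multiplied by [c], this is the Yosida approximation of the subdifferential of [j], a subgradient
    of the envelope by [env_subgradient]. *)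
Definition residual x := x - prox x.

Let prox_mono x z : 0 <= (residual x - residual z) * (prox x - prox z).
Proof.
have := prox_variational x (proxP z); have := prox_variational z (proxP x).
rewrite /residual; move: (prox x) (prox z) (jP x) (jP z) => P Q J J' h1 h2.
have : 0 <= c * ((x - P - (z - Q)) * (P - Q)) by lra.
by rewrite pmulr_rge0.
Qed.

(** With [a] the increment of the residual and [b] that of the identity, [prox_mono] reads
    [0 <= a * (b - a)]. Hence [0 <= a * b <= b^2], and [th = a / b] lies in the unit interval. *)
Lemma residual_between x z :
  exists2 th, 0 <= th <= 1 & residual x - residual z = th * (x - z).
Proof.
have [->|xz] := eqVneq x z; first by exists 0; rewrite ?subrr ?mulr0 ?lexx ?ler01.
have xz0 : x - z != 0 by rewrite subr_eq0.
exists ((residual x - residual z) / (x - z)); last by rewrite divfK.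
have := prox_mono x z.
rewrite (_ : prox x - prox z = (x - z) - (residual x - residual z)); last first.
  by rewrite /residual; ring.
move: (residual x - residual z) (x - z) xz0 => a b b0 h.
have b2 : 0 < b ^+ 2 by rewrite exprn_even_gt0.
have -> : a / b = (a * b) / b ^+ 2 by field.
have a2 := sqr_ge0 a; have ab := sqr_ge0 (b - a).
have ab0 : 0 <= a * b by nra.
have ab1 : a * b <= b ^+ 2 by nra.
apply/andP; split; first by rewrite divr_ge0// ltW.
by rewrite ler_pdivrMr// mul1r.
Qed.

Lemma residual0 : residual 0 = 0.
Proof.
have : (j 0 <= 0%:E)%E by rewrite j0.
move=> /(prox_variational 0); have := le_trans (j_ge0 _) (proxP 0).
rewrite lee_fin /residual !sub0r => h1 h2.
have : c * prox 0 ^+ 2 <= 0 by nra.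
rewrite pmulr_rle0// => h.
have : prox 0 ^+ 2 == 0 by rewrite eq_le h sqr_ge0.
by rewrite sqrf_eq0 => /eqP ->; rewrite oppr0.
Qed.

Lemma residual_lipschitz x z : `|residual x - residual z| <= `|x - z|.
Proof.
have [th /andP[th0 th1] ->] := residual_between x z.
by rewrite normrM ger0_norm// ler_piMl.
Qed.

Lemma residual_norm x : `|residual x| <= `|x|.
Proof. by have := residual_lipschitz x 0; rewrite residual0 !subr0. Qed.

Lemma continuous_residual : continuous residual.
Proof.
move=> x; apply/cvgrPdist_lt => e e0.
have /cvgrPdist_lt/(_ _ e0) := @cvg_id R (nbhs x).
by apply: filterS => z; exact: le_lt_trans (residual_lipschitz _ _).
Qed.

Lemma measurable_residual : measurable_fun setT residual.
Proof. exact: continuous_measurable_fun continuous_residual. Qed.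

(** Apply the variational inequality at [x] to the point [prox z]; what remains is the square
    [c / 2 * (residual z - residual x)^2]. *)
Lemma env_subgradient x z :
  moreau_env c x + c * residual x * (z - x) <= moreau_env c z.
Proof.
have := prox_variational x (proxP z); rewrite -/env /jP /residual.
move: (env x) (env z) (prox x) (prox z) => E E' P Q.
by have := mulr_ge0 (ltW c0) (sqr_ge0 ((z - Q) - (x - P))); nra.
Qed.

Lemma env_ge0 x : 0 <= moreau_env c x.
Proof.
have := le_trans (j_ge0 _) (proxP x); rewrite lee_fin /jP -/env.
by have := mulr_ge0 (ltW c0) (sqr_ge0 (x - prox x)); lra.
Qed.

Lemma env_le_sqr x : moreau_env c x <= c / 2 * x ^+ 2.
Proof.
have : (j 0 <= 0%:E)%E by rewrite j0.
by move=> /(env_leD x); rewrite subr0 add0r.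
Qed.

Lemma env_le_fun x : ((moreau_env c x)%:E <= j x)%E.
Proof.
have := j_ge0 x; case E : (j x) => [r| |]// _; rewrite ?leey// lee_fin.
have : (j x <= r%:E)%E by rewrite E.
by move=> /(env_leD x); rewrite subrr expr0n mulr0 addr0.
Qed.

Lemma prox_le_env x : (j (prox x) <= (moreau_env c x)%:E)%E.
Proof.
apply: le_trans (proxP x) _; rewrite lee_fin /jP gerBl.
by rewrite mulr_ge0 ?sqr_ge0// divr_ge0// ltW.
Qed.

Lemma residual_sqr_le x : c / 2 * residual x ^+ 2 <= moreau_env c x.
Proof.
by have := le_trans (j_ge0 _) (proxP x); rewrite lee_fin subr_ge0.
Qed.

Lemma measurable_env : measurable_fun setT (moreau_env c).
Proof.
(* The minimiser turns the infimum over all [y] into a formula in [j] and the continuous map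
   [residual]. *)
have -> : moreau_env c = (fun x => fine (j (x - residual x)) + c / 2 * residual x ^+ 2).
  by apply/funext => x; rewrite /residual subKr jPE /= /jP subrK.
apply: measurable_funD; last first.
  by apply: measurable_funM => //; apply: measurable_funX; exact: measurable_residual.
apply: measurableT_comp; first exact: fine_measurable.
apply: measurableT_comp; first exact: measurable_admissible.
by apply: measurable_funB => //; exact: measurable_residual.
Qed.

End fixed_parameter.

Lemma env_mono c c' x : 0 < c -> c <= c' -> moreau_env c x <= moreau_env c' x.
Proof.
move=> c0 cc'; have c'0 : 0 < c' by exact: lt_le_trans cc'.
rewrite {2}/moreau_env; apply: lb_le_inf.
  by exists (c' / 2 * x ^+ 2); exists 0; rewrite /penalized j0 subr0 subrr.
move=> r [y h]; apply: ge_inf.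
  exists 0 => s [z] /(le_trans (j_ge0 _)); rewrite lee_fin.
  by have := mulr_ge0 (ltW c0) (sqr_ge0 (x - z)); lra.
exists y; apply: le_trans h _; rewrite lee_fin lerB// ler_wpM2r ?sqr_ge0//.
by rewrite ler_pM2r.
Qed.

(** If the limit is a real [a], then [residual_sqr_le] bounds the squared residual for the parameter
    [n.+1] by [2 a / n.+1]. So the proximal points tend to [x], [j] is at most [a] at each of them,
    and lower semicontinuity concludes. *)
Lemma fun_le_lim_env x : (j x <= limn (fun n => (moreau_env n.+1%:R x)%:E))%E.
Proof.
have n0 n : 0 < n.+1%:R :> R by rewrite ltr0n.
have nd : nondecreasing_seq (fun n => (moreau_env n.+1%:R x)%:E).
  by move=> n k nk; rewrite lee_fin; apply: env_mono => //; rewrite ler_nat.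
have ub n : ((moreau_env n.+1%:R x)%:E <= limn (fun n => (moreau_env n.+1%:R x)%:E))%E.
  rewrite (cvg_lim _ (ereal_nondecreasing_cvgn nd))//.
  by apply: ereal_sup_ubound; exists n.
case E : (limn _) ub => [a| |] ub; rewrite ?leey//; last by have := ub 0%N.
have ub' n : moreau_env n.+1%:R x <= a by rewrite -lee_fin.
apply: (@j_lsc (fun n => prox (n0 n) x)) => [|e e0].
  apply/cvgrPdist_lt => e e0.
  have a1 : 0 < 2 * a + 1.
    by have := le_trans (env_ge0 (n0 0%N) x) (ub' 0%N); lra.
  have h0 : 0 < e ^+ 2 / (2 * a + 1) by rewrite divr_gt0 ?exprn_gt0.
  near=> n.
  have := le_trans (residual_sqr_le (n0 n) x) (ub' n); rewrite /residual.
  move: (x - prox (n0 n) x) => t h.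
  have : n.+1%:R^-1 < e ^+ 2 / (2 * a + 1).
    by near: n; exact: near_infty_natSinv_lt (PosNum h0).
  rewrite ltr_pdivlMr// => hn; rewrite ltNge; apply/negP => et.
  have : e ^+ 2 <= `|t| ^+ 2 by rewrite lerXn2r ?nnegrE// ltW.
  rewrite real_normK ?num_real// => et2.
  have w0 : 0 < n.+1%:R^-1 :> R by rewrite invr_gt0.
  have : t ^+ 2 <= 2 * a * n.+1%:R^-1.
    by rewrite ler_pdivlMr//; lra.
  by move: (n.+1%:R^-1) hn w0 => w; lra.
apply: nearW => n; apply: le_trans (prox_le_env (n0 n) x) _.
by rewrite lee_fin (le_trans (ub' n))// lerDl ltW.
Unshelve. all: by end_near. Qed.

End moreau.

(** * The subdifferential of the sum *)

Section arithmetic.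
Context {R : realDomainType}.

(** [P] and [Q] are the powers at [grad (w n)] and [grad u], and [S] is [psi] at [grad (w n)].
    Taking the subgradient at the moved point bounds the increase of the energy from above, which is
    why the flux of [w n] appears in the quotients. *)
Lemma tilted_bound (P Q S p a b t k : R) :
  (P + p * (S * (a - (a + t * b)))) * k <= Q * k ->
  P * k <= Q * k + p * (t * (S * k * b)).
Proof. lra. Qed.

End arithmetic.

(** [E1], [E2], [E3] are the values of [aenergy] at [u], [u + t h], [u + h]; [P1], [P2] the scaled
    p-energies at the first two; [I] the flux integral; [V] the integral of [v h]. Convexity gives
    [E2 - E1 <= t (E3 - E1)], so every term carries the factor [t]. *)
Lemma quotient_bound {R : realFieldType} (t P1 P2 E1 E2 E3 I V : R) : 0 < t ->
  2^-1 * E1 + P1 + t * V <= 2^-1 * E2 + P2 ->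
  E2 <= (1 - t) * E1 + t * E3 -> P2 <= P1 + 2^-1 * (t * I) ->
  V <= 2^-1 * (E3 - E1) + 2^-1 * I.
Proof. by move=> t0 h1 h2 h3; rewrite -(ler_pM2l t0); lra. Qed.

Lemma exchange_bound {R : realFieldType} (c A1 A2 B1 B2 P1 P2 Q1 Q2 V1 V2 : R) :
  0 <= c ->
  2^-1 * A1 + c * P1 - V1 <= 2^-1 * B1 + c * Q1 ->
  2^-1 * A2 + c * P2 + V2 <= 2^-1 * B2 + c * Q2 ->
  B1 + B2 <= A1 + A2 -> Q1 + Q2 <= P1 + P2 -> 0 <= V1 - V2.
Proof. by move=> c0 h1 h2 h3 /(ler_wpM2l c0); lra. Qed.

Section sum_of_functionals.
Context {d : measure_display} {X : measurableType d} {R : realType}.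
Variables (nu : {measure set X -> \bar R}) (m : X -> probability X R).
Hypotheses (hm : kernel_measurable m) (hrev : nu_reversible nu m).
Hypothesis nu_sfin : sigma_finite setT nu.
Variables (A B : X -> set X) (p : R).
Hypothesis mA : measurable [set z : X * X | A z.1 z.2].
Hypothesis mB : measurable [set z : X * X | B z.1 z.2].
Hypothesis p1 : 1 < p.
Hypothesis fin_or_p2 : (nu setT < +oo)%E \/ 2 <= p.
Implicit Types (u v w h : X -> R).

Local Notation M := (nuxm_measure nu hm).
Local Notation KA := (Kset A : X * X -> R).
Local Notation KB := (Kset B : X * X -> R).
Local Notation pfinB := (pfin nu hm KB p).
Local Notation flux u := (pflux KB p u).
Local Notation lap u := (kint m (pflux KB p u)).
Let FA := FA1 nu m A.
Let FB := FBp nu m B p.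
Let F u := (FA u + FB u)%E.

Let mKA : measurable_fun setT KA. Proof. exact: measurable_Kset. Qed.
Let mKB : measurable_fun setT KB. Proof. exact: measurable_Kset. Qed.
Let KB0 z : 0 <= KB z. Proof. exact: Kset_ge0. Qed.
Let KB1 z : KB z <= 1. Proof. exact: Kset_le1. Qed.
Let KBs z : KB (z.2, z.1) = KB z. Proof. exact: Kset_sym. Qed.
Let p0 : 0 < p. Proof. exact: lt_trans p1. Qed.
Let c0 : 0 < (2 * p)^-1. Proof. by rewrite invr_gt0 mulr_gt0. Qed.
Let half0 : 0 < 2^-1 :> R. Proof. by rewrite invr_gt0. Qed.

Definition afin u := rintegrable M (fun z => `|grad u z| * KA z).
Definition aenergy u := \int[M]_z (`|grad u z| * KA z).
Definition penergy u := \int[M]_z (`|grad u z| `^ p * KB z).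

Lemma FA1_ge0 u : (0 <= FA u)%E.
Proof.
apply: mule_ge0; first by rewrite lee_fin ltW.
by apply: energy_ge0 => // z; exact: Kset_ge0.
Qed.

Lemma FBp_ge0 u : (0 <= FB u)%E.
Proof.
apply: mule_ge0; first by rewrite lee_fin ltW.
apply: (@energy_ge0 _ _ _ nu m (fun t => `|t| `^ p)) => z.
  exact: powR_ge0.
exact: Kset_ge0.
Qed.

Lemma FA1_ltyP u : measurable_fun setT u -> (FA u < +oo)%E <-> afin u.
Proof.
move=> mu; apply: (@cenergy_ltyP _ _ _ nu m hm (fun t : R => `|t|)) => //.
by move=> z; exact: Kset_ge0.
Qed.

Lemma FBp_ltyP u : measurable_fun setT u -> (FB u < +oo)%E <-> pfinB u.
Proof.
move=> mu; apply: (@cenergy_ltyP _ _ _ nu m hm (fun t => `|t| `^ p)) => //.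
exact: measurable_pow.
Qed.

Lemma FA1_fin u : measurable_fun setT u -> afin u -> FA u = (2^-1 * aenergy u)%:E.
Proof.
move=> mu ui; rewrite EFinM; congr (_ * _)%E.
apply: (@energy_fin _ _ _ nu m hm (fun t : R => `|t|)) => //.
by move=> z; exact: Kset_ge0.
Qed.

Lemma FBp_fin u : measurable_fun setT u -> pfinB u ->
  FB u = ((2 * p)^-1 * penergy u)%:E.
Proof.
move=> mu ui; rewrite EFinM; congr (_ * _)%E.
apply: (@energy_fin _ _ _ nu m hm (fun t => `|t| `^ p)) => //.
exact: measurable_pow.
Qed.

Lemma F_ltyP u : measurable_fun setT u -> (F u < +oo)%E <-> afin u /\ pfinB u.
Proof.
move=> mu; rewrite -FA1_ltyP// -FBp_ltyP//; split=> [h|[a b]]; last exact: lte_add_pinfty.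
split; apply: le_lt_trans h.
  exact: leeDl (FBp_ge0 u).
exact: leeDr (FA1_ge0 u).
Qed.

Lemma afin_le u h : measurable_fun setT h -> afin u ->
  (forall z, `|grad h z| <= `|grad u z|) -> afin h.
Proof.
move=> mh ui hu; apply: rintegrable_le ui _.
  by apply: (measurable_density (phi := fun t : R => `|t|)) => //; exact: normr_measurable.
by move=> z; rewrite ger0_norm ?mulr_ge0 ?Kset_ge0// ler_wpM2r ?Kset_ge0.
Qed.

Lemma afin_conv u h (t : R) : measurable_fun setT u -> measurable_fun setT h ->
  0 <= t <= 1 -> afin u -> afin (fun x => u x + h x) ->
  afin (fun x => u x + t * h x) /\
  aenergy (fun x => u x + t * h x) <=
    (1 - t) * aenergy u + t * aenergy (fun x => u x + h x).
Proof.
move=> mu mh /andP[t0 t1] ui uhi.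
have mw : measurable_fun setT (fun x => u x + t * h x).
  by apply: measurable_funD => //; exact: measurable_funM.
have ri := rintegrableD (rintegrableZ (1 - t) ui) (rintegrableZ t uhi).
have le z : `|grad (fun x => u x + t * h x) z| * KA z <=
    (1 - t) * (`|grad u z| * KA z) + t * (`|grad (fun x => u x + h x) z| * KA z).
  move: (KA z) (Kset_ge0 (R := R) A z) => k k0.
  rewrite !mulrA -mulrDl ler_wpM2r//.
  have -> : grad (fun x => u x + t * h x) z =
      (1 - t) * grad u z + t * grad (fun x => u x + h x) z by rewrite /grad; ring.
  apply: le_trans (ler_normD _ _) _.
  by rewrite !normrM (ger0_norm t0) ger0_norm// subr_ge0.
have wi : afin (fun x => u x + t * h x).
  apply: rintegrable_le ri _.
    by apply: (measurable_density (phi := fun t : R => `|t|)) => //; exact: normr_measurable.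
  by move=> z; rewrite ger0_norm ?mulr_ge0 ?Kset_ge0.
split=> //; apply: le_trans (le_rintegral wi ri le) _.
by rewrite rintegralD ?rintegralZ//; exact: rintegrableZ.
Qed.

(* The difference quotients of the p-energy are bounded by
   [\int psi (grad u + t grad h) K grad h], which is dominated as [t -> 0]. *)
Lemma directional_subgradient u v h : subdiff nu F u v -> L2 nu h ->
  afin (fun x => u x + h x) -> pfinB h ->
  \int[nu]_x (v x * h x) <=
  2^-1 * (aenergy (fun x => u x + h x) - aenergy u) +
  2^-1 * \int[M]_z (flux u z * grad h z).
Proof.
move=> [u2 [v2 [Fu sub]]] h2 ahi phi; have mu := L2_measurable u2.
have mh := L2_measurable h2; have [ui pui] := (F_ltyP mu).1 Fu.
pose t n : R := n.+1%:R^-1.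
have t0 n : 0 < t n by rewrite invr_gt0.
have t1 n : t n <= 1 by rewrite invf_le1 ?ler1n.
pose w n x := u x + t n * h x.
have w2 n : L2 nu (w n) by apply: L2D => //; exact: L2Z.
have mw n := L2_measurable (w2 n).
have gw n z : grad (w n) z = grad u z + t n * grad h z by rewrite /grad /w; ring.
have nt n : `|t n| <= 1 by rewrite ger0_norm// ltW.
have pwi n : pfinB (w n).
  by apply: pfinD => // z; exact: Kset_ge0.
have fwi n : rintegrable M (fun z => flux (w n) z * grad h z).
  by apply: pflux_grad => // z; exact: Kset_ge0.
have step n : \int[nu]_x (v x * h x) <=
    2^-1 * (aenergy (fun x => u x + h x) - aenergy u) +
    2^-1 * \int[M]_z (flux (w n) z * grad h z).
  have t01 : 0 <= t n <= 1 by rewrite t1 ltW.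
  have [awi awle] := afin_conv mu mh t01 ui ahi.
  have := sub _ (w2 n).
  rewrite /F (FA1_fin mu ui) (FBp_fin mu pui) (FA1_fin (mw n) awi).
  rewrite (FBp_fin (mw n) (pwi n)).
  have vh := L2_mul v2 h2.
  have -> : (\int[nu]_x (v x * (w n x - u x))%:E = (t n * \int[nu]_x (v x * h x))%:E)%E.
    rewrite -(rintegralZ (t n) vh) -rintegralE; last exact: rintegrableZ.
    by apply: eq_integral => x _; congr EFin; rewrite /w; ring.
  rewrite !lee_fin => main.
  have pen : penergy (w n) <= penergy u + p * (t n * \int[M]_z (flux (w n) z * grad h z)).
    rewrite /penergy -rintegralZ// -rintegralZ; last exact: rintegrableZ.
    have ii := rintegrableZ p (rintegrableZ (t n) (fwi n)).
    rewrite -(rintegralD pui ii); apply: (le_rintegral (pwi n) (rintegrableD pui ii)).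
    move=> z; have := psi_subgradient p1 (grad u z) (grad (w n) z).
    move=> /(ler_wpM2r (KB0 z)); rewrite /pflux gw.
    exact: tilted_bound.
  have e : 2^-1 * (t n * \int[M]_z (flux (w n) z * grad h z)) =
      (2 * p)^-1 * (p * (t n * \int[M]_z (flux (w n) z * grad h z))).
    by field; rewrite gt_eqF.
  have {e}pen : (2 * p)^-1 * penergy (w n) <= (2 * p)^-1 * penergy u +
      2^-1 * (t n * \int[M]_z (flux (w n) z * grad h z)).
    by rewrite e -mulrDr ler_pM2l.
  exact: quotient_bound (t0 n) main awle pen.
have cv_t : t n @[n --> \oo] --> (0 : R).
  exact: cvg_harmonic.
have [_ L] : rintegrable M (fun z => flux u z * grad h z) /\
    \int[M]_z (flux (w n) z * grad h z) @[n --> \oo] -->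
    \int[M]_z (flux u z * grad h z).
  have dom := rintegrableD (rintegrableZ (2 `^ p) (rintegrableD pui phi)) phi.
  apply: (rdominated_convergence _ _ dom).
  - by move=> n; exact: rintegrable_measurable (fwi n).
  - move=> z; apply: cvgM; last exact: cvg_cst.
    apply: cvgM; last exact: cvg_cst.
    have cg : grad (w n) z @[n --> \oo] --> grad u z.
      have : grad u z + t n * grad h z @[n --> \oo] --> grad u z + 0 * grad h z.
        by apply: cvgD; [exact: cvg_cst|apply: cvgM => //; exact: cvg_cst].
      by rewrite mul0r addr0; under [in X in _ -> X]eq_fun do rewrite gw.
    apply: (@cvg_comp _ _ _ (fun n => grad (w n) z) (psi p) _ _ _ cg).
    exact: psi_continuous.
  - move=> n z; rewrite /pflux.
    move: (KB z) (Kset_ge0 (R := R) B z) => k k0.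
    rewrite mulrAC normrM (ger0_norm k0).
    rewrite [leRHS](_ : _ = (2 `^ p * (`|grad u z| `^ p + `|grad h z| `^ p) +
      `|grad h z| `^ p) * k); last by ring.
    rewrite ler_wpM2r//.
    apply: le_trans (psi_young p1 _ _) _; rewrite lerD2r gw.
    apply: le_trans (powR_add_le p1 _ _) _; rewrite ler_wpM2l ?powR_ge0// lerD2l.
    by apply: powR_le_norm => //; rewrite normrM ler_piMl.
have L' : 2^-1 * (aenergy (fun x => u x + h x) - aenergy u) +
    2^-1 * \int[M]_z (flux (w n) z * grad h z) @[n --> \oo] -->
    2^-1 * (aenergy (fun x => u x + h x) - aenergy u) +
    2^-1 * \int[M]_z (flux u z * grad h z).
  by apply: cvgD; [exact: cvg_cst|apply: cvgM => //; exact: cvg_cst].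
by apply: (cvgr_to_ge L'); exact: nearW.
Qed.

(** Both marginals of [M] are [nu] and the conductance is at most [1], hence the constant [2];
    multiplied by the [2^-1] of [FA1] it becomes the [1] of [subdiff_lap_bounded]. *)
Lemma afin_add u h : measurable_fun setT u -> afin u -> rintegrable nu h ->
  afin (fun x => u x + h x) /\
  aenergy (fun x => u x + h x) <= aenergy u + 2 * \int[nu]_x `|h x|.
Proof.
move=> mu ui hi; have mh := rintegrable_measurable hi.
have ai := rintegrable_abs hi.
have i1 := nuxm_rintegrable_fst hm ai; have i2 := nuxm_rintegrable_snd hm hrev ai.
have ri := rintegrableD ui (rintegrableD i1 i2).
have le z : `|grad (fun x => u x + h x) z| * KA z <=
    `|grad u z| * KA z + (`|h z.1| + `|h z.2|).
  have := Kset_le1 (R := R) A z; have := Kset_ge0 (R := R) A z.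
  move: (KA z) => k k0 k1.
  have -> : grad (fun x => u x + h x) z = grad u z + (h z.2 - h z.1).
    by rewrite /grad; ring.
  apply: le_trans (ler_wpM2r k0 (ler_normD _ _)) _; rewrite mulrDl lerD2l.
  apply: le_trans (ler_piMr (normr_ge0 _) k1) _.
  by rewrite [leRHS]addrC; exact: ler_normB.
have wi : afin (fun x => u x + h x).
  apply: rintegrable_le ri _.
    apply: (measurable_density (phi := fun t : R => `|t|)) => //.
    exact: measurable_funD.
  by move=> z; rewrite ger0_norm ?mulr_ge0 ?Kset_ge0.
split=> //; apply: le_trans (le_rintegral wi ri le) _.
rewrite rintegralD//; last exact: rintegrableD.
rewrite rintegralD// (nuxm_rintegral_fst hm ai) (nuxm_rintegral_snd hm hrev ai).
by rewrite /aenergy; lra.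
Qed.

Lemma measurable_lap u : measurable_fun setT u -> measurable_fun setT (lap u).
Proof.
by move=> mu; apply: (measurable_kint hm); exact: measurable_pflux.
Qed.

Lemma subdiff_test_bounded u v h (c : R) : subdiff nu F u v ->
  L2 nu h -> rintegrable nu h -> (forall x, `|h x| <= c) ->
  rintegrable nu (fun x => (v x + lap u x) * h x) /\
  \int[nu]_x ((v x + lap u x) * h x) <= \int[nu]_x `|h x|.
Proof.
move=> Fuv h2 hi hc; have [u2 [v2 [Fu _]]] := Fuv.
have mu := L2_measurable u2; have [ui pui] := (F_ltyP mu).1 Fu.
have mh := L2_measurable h2.
have [ai ale] := afin_add mu ui hi.
have phi : pfinB h := pfin_bounded hm hrev mKB KB0 KB1 p1 fin_or_p2 h2 hc.
have main := directional_subgradient Fuv h2 ai phi.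
have mfl : measurable_fun setT (flux u) by exact: measurable_pflux.
have flh : rintegrable M (fun z => flux u z * h z.1).
  exact: (pflux_bounded hrev mKB KB0 KB1 p1 fin_or_p2 u2 pui h2 hc).
have anti z : flux u (z.2, z.1) = - flux u z by exact: pflux_antisym.
have li := rintegrable_kint_mul mfl flh.
have vi := L2_mul v2 h2.
have e : (fun x => (v x + lap u x) * h x) = (fun x => v x * h x + lap u x * h x).
  by apply/funext => x; rewrite mulrDl.
rewrite e; split; first exact: rintegrableD.
rewrite rintegralD//; move: main.
by rewrite (integration_by_parts hrev mfl anti flh); lra.
Qed.

Lemma subdiff_lap_bounded u v : subdiff nu F u v ->
  {ae nu, forall x, `|v x + lap u x| <= 1}.
Proof.
move=> Fuv; have [u2 [v2 _]] := Fuv.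
have mz : measurable_fun setT (fun x => v x + lap u x).
  apply: measurable_funD; first exact: L2_measurable v2.
  by apply: measurable_lap; exact: L2_measurable u2.
have [S ST Sfin] := nu_sfin.
(* The sign [s] is [1] or [-1], and [S n] makes the measure finite. Tested with [s * \1_E], the
   nonnegative function [(s * (v + lap u) - 1) * \1_E] has a nonpositive integral, so it vanishes
   almost everywhere although it is positive on [E]. *)
pose E (s : R) n := [set x | 1 < s * (v x + lap u x)] `&` S n.
have nE s n : `|s| = 1 -> nu.-negligible (E s n).
  move=> s1; have [mS Sy] := Sfin n.
  have mE : measurable (E s n).
    apply: measurableI => //.
    have ms : measurable_fun setT (fun x => s * (v x + lap u x)).
      exact: measurable_funM.
    rewrite [X in measurable X](_ : _ = setT `&`
      (fun x => s * (v x + lap u x)) @^-1` `]1, +oo[%classic); first exact: ms.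
    by rewrite setTI; apply/seteqP; split=> x /=; rewrite in_itv/= andbT.
  have Ey : (nu (E s n) < +oo)%E.
    apply: le_lt_trans Sy; apply: le_measure; rewrite ?inE//; exact: subIsetr.
  have E2 := L2_indic mE Ey.
  have Ei : rintegrable nu (\1_(E s n)).
    apply: rintegrable_ge0 => //.
    by rewrite integral_indic// setIT.
  have hc x : `|s * \1_(E s n) x| <= 1.
    by rewrite normrM s1 mul1r indicE; case: (_ \in _); rewrite ?normr1 ?normr0.
  have [zi zle] := subdiff_test_bounded Fuv (L2Z s E2) (rintegrableZ s Ei) hc.
  have ai := rintegrable_abs (rintegrableZ s Ei).
  have fi := rintegrableB zi ai.
  have fE x : (v x + lap u x) * (s * \1_(E s n) x) - `|s * \1_(E s n) x| =
      (s * (v x + lap u x) - 1) * \1_(E s n) x.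
    by rewrite normrM s1 mul1r ger0_norm//; ring.
  have f0 x : 0 <= (v x + lap u x) * (s * \1_(E s n) x) - `|s * \1_(E s n) x|.
    rewrite fE indicE; have [|_] := boolP (x \in _); last by rewrite mulr0.
    by rewrite inE mulr1 => -[/= + _]; rewrite subr_ge0 => /ltW.
  have : {ae nu, forall x, (s * (v x + lap u x) - 1) * \1_(E s n) x = 0}.
    have := rintegral_ge0_eq0 fi f0; rewrite rintegralB// subr_le0 => /(_ zle).
    by apply: filterS => x <-.
  apply: negligibleS => x Ex /= /eqP.
  rewrite indicE mem_set// mulr1 subr_eq0 => /eqP h1.
  by case: Ex => /=; rewrite h1 ltxx.
have : nu.-negligible (\bigcup_n (E 1 n `|` E (-1) n)).
  apply: negligible_bigcup => n.
  by apply: negligibleU; apply: nE; rewrite ?normrN normr1.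
apply: negligibleS => x /= /negP; rewrite -ltNge => h.
have : setT x by []; rewrite ST => -[n _ Sx]; exists n => //.
move: h; case: (ger0P (v x + lap u x)) => _ h; [left|right]; split=> //=.
  by rewrite mul1r.
by rewrite mulN1r.
Qed.

Lemma subdiff_lap_L2 u v : subdiff nu F u v -> L2 nu (lap u).
Proof.
move=> Fuv; have [u2 [v2 [Fu _]]] := Fuv; have mu := L2_measurable u2.
have [_ pui] := (F_ltyP mu).1 Fu.
have bnd := subdiff_lap_bounded Fuv.
have ml := measurable_lap mu; have /L2P[_ v2'] := v2.
apply/L2P; split=> //.
have sq (a b : R) : `|a + b| <= 1 -> b ^+ 2 <= 2 * a ^+ 2 + 2.
  by rewrite ler_norml => /andP[h1 h2]; have := sqr_ge0 (a - b); have := sqr_ge0 (2 * a + b); nra.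
case: fin_or_p2 => [nuy|p2].
  have c2 : rintegrable nu (fun=> 2).
    apply/integrableP; split; first exact/measurable_EFinP.
    by rewrite /= integral_cst//= lte_mul_pinfty.
  apply: rintegrable_le_ae (rintegrableD (rintegrableZ 2 v2') c2) _.
    exact: measurable_funX.
  by move: bnd; apply: filterS => x /sq; rewrite ger0_norm ?sqr_ge0.
have g2 := L2_grad hm hrev u2.
have mg2 := rintegrable_measurable g2; have mp := rintegrable_measurable pui.
have dom := rintegrableD (rintegrableD (rintegrableZ 2 (kint_rintegrable mg2 g2))
  (rintegrableZ 2 (kint_rintegrable mp pui))) (rintegrableZ 2 v2').
apply: rintegrable_le_ae dom _; first exact: measurable_funX.
have s1 := ae_rintegrable_section mg2 g2; have s2 := ae_rintegrable_section mp pui.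
apply: filterS3 bnd s1 s2 => x /sq bx i1 i2.
rewrite ger0_norm ?sqr_ge0//.
have mgx : measurable_fun setT (fun y => grad u (x, y)).
  by apply: (measurable_fun_section x); exact: measurable_grad.
have [gi gle] := probability_sqr_le mgx i1.
have lle : `|lap u x| <= \int[m x]_y `|grad u (x, y)| + kint m (fun z => `|grad u z| `^ p * KB z) x.
  rewrite /kint -rintegralD//.
  have fi : rintegrable (m x) (fun y => flux u (x, y)).
    apply: rintegrable_le (rintegrableD gi i2) _.
      by apply: (measurable_fun_section x); exact: measurable_pflux.
    move=> y; rewrite /pflux.
    have := Kset_le1 (R := R) B (x, y); have := Kset_ge0 (R := R) B (x, y).
    move: (KB (x, y)) => k k0 k1; rewrite normrM (ger0_norm k0) norm_psi//.
    apply: le_trans (ler_wpM2r k0 (powRB1_le_linear _ p2)) _.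
    by rewrite mulrDl lerD2r ler_piMr.
  apply: le_trans (le_normr_Rintegral measurableT fi) _.
  apply: le_rintegral; [exact: rintegrable_abs|exact: rintegrableD|].
  move=> y; rewrite /pflux.
  have := Kset_le1 (R := R) B (x, y); have := Kset_ge0 (R := R) B (x, y).
  move: (KB (x, y)) => k k0 k1; rewrite normrM (ger0_norm k0) norm_psi//.
  apply: le_trans (ler_wpM2r k0 (powRB1_le_linear _ p2)) _.
  by rewrite mulrDl lerD2r ler_piMr.
have D20 : 0 <= kint m (fun z => `|grad u z| `^ p * KB z) x.
  by apply: Rintegral_ge0 => y _; rewrite mulr_ge0 ?powR_ge0 ?Kset_ge0.
have D10 : 0 <= \int[m x]_y `|grad u (x, y)| by apply: Rintegral_ge0.
have G0 : 0 <= kint m (fun z => grad u z ^+ 2) x.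
  by apply: Rintegral_ge0 => y _; exact: sqr_ge0.
move: bx gle lle D20 D10 G0; rewrite -[X in X <= 2 * _ + 2]real_normK ?num_real//.
rewrite -[X in X <= _ + 2 * v x ^+ 2]real_normK ?num_real// /kint.
move: (\int[m x]_y `|grad u (x, y)|) (`|Rintegral _ _ _|) (normr_ge0 (lap u x)).
move=> D1 L L0; move: (\int[m x]_y (grad u (x, y) ^+ 2)) => G.
move: (\int[m x]_y _) => D2 bx gle lle D20 D10 G0.
(* [D1] is the square integrable part of the bound on [|lap u|], [D2] the integrable one. Where
   [D2 <= 1], [D2^2 <= D2] and the square of the sum is at most [2 G + 2 D2]. Where [D2 > 1], the a
   priori bound [2 v^2 + 2] is at most [2 v^2 + 2 D2]. *)
have v0 := sqr_ge0 (v x); have [D21|D21] := leP D2 1; last by lra.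
have : L ^+ 2 <= (D1 + D2) ^+ 2 by rewrite lerXn2r ?nnegrE ?addr_ge0.
by have := sqr_ge0 (D1 - D2); nra.
Qed.

(** A competitor [w] with finite [FA1] may have infinite p-energy, and then the inequality for the
    sum says nothing about it. Its truncations [T n] have finite p-energy, do not increase [aenergy]
    and tend to [w]; the direction [T n - u] yields the term in [lap u] by parts, now that [lap u]
    is in [L2]. *)
Lemma subdiff_split u v : subdiff nu F u v ->
  subdiff nu FA u (fun x => v x + lap u x).
Proof.
move=> Fuv; have [u2 [v2 [Fu _]]] := Fuv; have mu := L2_measurable u2.
have [ui pui] := (F_ltyP mu).1 Fu.
have l2 := subdiff_lap_L2 Fuv; have z2 := L2D v2 l2.
split=> //; split=> //; split; first exact/FA1_ltyP.
move=> w w2; have mw := L2_measurable w2.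
have [wi|wy] := pselect (afin w); last first.
  have : ~ (FA w < +oo)%E by move=> /(FA1_ltyP mw).
  by rewrite ltey => /negP; rewrite negbK => /eqP ->; exact: leey.
rewrite (FA1_fin mu ui) (FA1_fin mw wi) (rintegralE (L2_mul z2 (L2B w2 u2))) lee_fin.
pose T n x := clamp n%:R (w x).
have T2 n : L2 nu (T n) by exact: L2_clamp.
have mT n := L2_measurable (T2 n).
have h2 n := L2B (T2 n) u2.
have gT n z : `|grad (T n) z| <= `|grad w z| by exact: clamp_contract.
have aT n : afin (T n) by exact: afin_le (mT n) wi (gT n).
have aTle n : aenergy (T n) <= aenergy w.
  by apply: (le_rintegral (aT n) wi) => z; rewrite ler_wpM2r ?Kset_ge0.
have pT n : pfinB (T n).
  apply: (pfin_bounded hm hrev mKB KB0 KB1 p1 fin_or_p2 (T2 n) (c := n%:R)).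
  by move=> x; exact: clamp_le.
have ph n : pfinB (fun x => T n x - u x).
  have t1 : `|-1 : R| <= 1 by rewrite normrN1.
  have := pfinD mKB KB0 p1 (mT n) mu t1 (pT n) pui.
  by under eq_fun do rewrite mulN1r.
have step n : \int[nu]_x ((v x + lap u x) * (T n x - u x)) <=
    2^-1 * (aenergy w - aenergy u).
  have e : (fun x => u x + (T n x - u x)) = T n.
    by apply/funext => x; rewrite addrC subrK.
  have := @directional_subgradient u v _ Fuv (h2 n); rewrite e.
  move=> /(_ (aT n) (ph n)).
  rewrite (pflux_by_parts hrev mKB KB0 KB1 KBs p1 fin_or_p2 u2 pui l2 (h2 n) (ph n)).
  have -> : \int[nu]_x ((v x + lap u x) * (T n x - u x)) =
      \int[nu]_x (v x * (T n x - u x)) + \int[nu]_x (lap u x * (T n x - u x)).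
    rewrite -(rintegralD (L2_mul v2 (h2 n)) (L2_mul l2 (h2 n))).
    by apply: eq_Rintegral => x _; rewrite mulrDl.
  by have := aTle n; lra.
have dom := rintegrableD (rintegrable_abs (L2_mul z2 w2)) (rintegrable_abs (L2_mul z2 u2)).
have [_ L] : rintegrable nu (fun x => (v x + lap u x) * (w x - u x)) /\
    \int[nu]_x ((v x + lap u x) * (T n x - u x)) @[n --> \oo] -->
    \int[nu]_x ((v x + lap u x) * (w x - u x)).
  apply: (rdominated_convergence _ _ dom).
  - by move=> n; apply: measurable_funM; [exact: L2_measurable z2|exact: L2_measurable (h2 n)].
  - move=> x; apply: cvgM; first exact: cvg_cst.
    by apply: cvgB; [exact: cvg_clamp|exact: cvg_cst].
  - move=> n x; rewrite !normrM -mulrDr ler_wpM2l//.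
    by apply: le_trans (ler_normB _ _) _; rewrite lerD2r; exact: clamp_norm_le.
have : \int[nu]_x ((v x + lap u x) * (w x - u x)) <= 2^-1 * (aenergy w - aenergy u).
  by apply: (cvgr_to_le L); exact: nearW.
by lra.
Qed.

(** * Complete accretivity *)

Lemma subdiff_accretive (T : R -> R) u1 v1 u2 v2 :
  measurable_fun setT T -> T 0 = 0 ->
  (forall s t, exists2 th, 0 <= th <= 1 & T s - T t = th * (s - t)) ->
  subdiff nu F u1 v1 -> subdiff nu F u2 v2 ->
  0 <= \int[nu]_x ((v1 x - v2 x) * T (u1 x - u2 x)).
Proof.
move=> mT T0 Tb [u12 [v12 [Fu1 sub1]]] [u22 [v22 [Fu2 sub2]]].
have mu1 := L2_measurable u12; have mu2 := L2_measurable u22.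
have [a1 q1] := (F_ltyP mu1).1 Fu1; have [a2 q2] := (F_ltyP mu2).1 Fu2.
have Tu2 : L2 nu (fun x => T (u1 x - u2 x)).
  apply: L2_norm_le (L2B u12 u22) _.
    by apply: measurableT_comp => //; exact: measurable_funB.
  move=> x; have [th /andP[th0 th1]] := Tb (u1 x - u2 x) 0.
  by rewrite T0 !subr0 => ->; rewrite normrM ger0_norm// ler_piMl.
pose w1 x := u1 x - T (u1 x - u2 x); pose w2 x := u2 x + T (u1 x - u2 x).
have w12 : L2 nu w1 by exact: L2B.
have w22 : L2 nu w2 by exact: L2D.
have absc (s t th : R) : 0 <= th <= 1 ->
    `|(1 - th) * s + th * t| <= (1 - th) * `|s| + th * `|t|.
  move=> /andP[th0 th1]; apply: le_trans (ler_normD _ _) _.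
  by rewrite !normrM (ger0_norm th0) ger0_norm// subr_ge0.
have KA0 z : 0 <= KA z by exact: Kset_ge0.
have [b1 b2 ble] := energy_exchange (phi := fun t : R => `|t|) (@normr_measurable R setT)
  (@normr_ge0 _ _) mKA KA0 absc mT Tb mu1 mu2 a1 a2.
have powc := subgradient_convex (psi_subgradient p1).
have [r1 r2 rle] := energy_exchange (phi := fun t : R => `|t| `^ p) (@measurable_pow R p)
  (fun t => powR_ge0 _ _) mKB KB0 powc mT Tb mu1 mu2 q1 q2.
have mw1 := L2_measurable w12; have mw2 := L2_measurable w22.
have i1 := L2_mul v12 Tu2; have i2 := L2_mul v22 Tu2.
have := sub1 _ w12; have := sub2 _ w22.
have -> : (\int[nu]_x (v1 x * (w1 x - u1 x))%:E =
    (- \int[nu]_x (v1 x * T (u1 x - u2 x)))%:E)%E.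
  rewrite -rintegralN// -rintegralE; last exact: rintegrableN.
  by apply: eq_integral => x _; congr EFin; rewrite /w1; ring.
have -> : (\int[nu]_x (v2 x * (w2 x - u2 x))%:E =
    (\int[nu]_x (v2 x * T (u1 x - u2 x)))%:E)%E.
  rewrite -rintegralE//.
  by apply: eq_integral => x _; congr EFin; rewrite /w2; ring.
rewrite /F (FA1_fin mu1 a1) (FBp_fin mu1 q1) (FA1_fin mu2 a2) (FBp_fin mu2 q2).
rewrite (FA1_fin mw1 b1) (FBp_fin mw1 r1) (FA1_fin mw2 b2) (FBp_fin mw2 r2).
rewrite !lee_fin.
have -> : \int[nu]_x ((v1 x - v2 x) * T (u1 x - u2 x)) =
    \int[nu]_x (v1 x * T (u1 x - u2 x)) - \int[nu]_x (v2 x * T (u1 x - u2 x)).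
  rewrite -rintegralB//; apply: eq_Rintegral => x _; ring.
have e1 : aenergy w1 + aenergy w2 <= aenergy u1 + aenergy u2 by exact: ble.
have e2 : penergy w1 + penergy w2 <= penergy u1 + penergy u2 by exact: rle.
by move=> h1 h2; exact: exchange_bound (ltW c0) h2 h1 e1 e2.
Qed.

(** The subgradient inequality of the envelope [e n] at [a = u1 - u2] gives
    [\int e n (a) <= \int e n (f)], since its first-order term is nonnegative by
    [subdiff_accretive]. Replacing [e n] by [j] on the right only leaves a bound independent of [n],
    possibly infinite, and monotone convergence on the left concludes. *)
Lemma subdiff_completely_accretive : completely_accretive nu (subdiff nu F).
Proof.
move=> lam lam0 u1 v1 u2 v2 D1 D2 j hj.
have [u12 [v12 _]] := D1; have [u22 [v22 _]] := D2.
have a2 := L2B u12 u22; have b2 := L2B v12 v22.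
pose a x := u1 x - u2 x; pose f x := u1 x - u2 x + lam * (v1 x - v2 x).
have f2 : L2 nu f by exact: L2D (L2Z lam b2).
have ma := L2_measurable a2; have mf := L2_measurable f2.
have mj := measurable_admissible hj.
have j0 t : (0 <= j t)%E by case: hj.
have n0 n : 0 < n.+1%:R :> R by rewrite ltr0n.
pose e n := moreau_env j n.+1%:R.
have e0 n t : 0 <= e n t by exact: env_ge0.
have me n : measurable_fun setT (e n) by exact: measurable_env.
have mea n : measurable_fun setT (EFin \o (fun x => e n (a x))).
  by apply/measurable_EFinP; exact: measurableT_comp.
have ei g n : L2 nu g -> rintegrable nu (fun x => e n (g x)).
  move=> /L2P[mg g2].
  apply: (rintegrable_le _ (rintegrableZ (n.+1%:R / 2) g2)).
    exact: measurableT_comp.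
  by move=> x; rewrite ger0_norm//; exact: env_le_sqr.
have step n : (\int[nu]_x (e n (a x))%:E <= \int[nu]_x j (f x))%E.
  apply: (@le_trans _ _ (\int[nu]_x (e n (f x))%:E)%E); last first.
    apply: ge0_le_integral => //.
    - by move=> x _; rewrite lee_fin.
    - by apply/measurable_EFinP; exact: measurableT_comp.
    - exact: measurableT_comp.
    - by move=> x _; exact: env_le_fun.
  rewrite !rintegralE; [|exact: ei|exact: ei]; rewrite lee_fin.
  have acc := subdiff_accretive (measurable_residual hj (n0 n)) (residual0 hj (n0 n))
    (residual_between hj (n0 n)) D1 D2.
  have T2 : L2 nu (fun x => residual hj (n0 n) (a x)).
    apply: L2_norm_le (a2) _.
      exact: measurableT_comp (measurable_residual hj (n0 n)) ma.
    by move=> x; exact: residual_norm.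
  have bi := L2_mul b2 T2.
  have ri := rintegrableD (ei a n a2) (rintegrableZ (n.+1%:R * lam) bi).
  apply: (@le_trans _ _ (\int[nu]_x (e n (a x) +
      n.+1%:R * lam * ((v1 x - v2 x) * residual hj (n0 n) (a x))))).
    rewrite rintegralD ?rintegralZ//; [|exact: ei|exact: rintegrableZ].
    by rewrite lerDl mulr_ge0// mulr_ge0// ltW.
  apply: le_rintegral ri (ei f n f2) _ => x.
  apply: le_trans (env_subgradient hj (n0 n) (a x) (f x)).
  rewrite lerD2l /f -/(a x) le_eqVlt; apply/orP; left; apply/eqP; ring.
have nd x : nondecreasing_seq (fun n => (e n (a x))%:E).
  by move=> n k nk; rewrite lee_fin; apply: env_mono => //; rewrite ler_nat.
apply: (@le_trans _ _ (\int[nu]_x limn (fun n => (e n (a x))%:E))%E).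
  apply: ge0_le_integral => //.
  - exact: measurableT_comp mj ma.
  - apply: (emeasurable_fun_cvg (fun n x => (e n (a x))%:E)) => // x _.
    exact: ereal_nondecreasing_is_cvgn.
  - by move=> x _; exact: fun_le_lim_env.
rewrite monotone_convergence//; last by move=> n x _; rewrite lee_fin.
apply: lime_le; last by apply: nearW.
apply: ereal_nondecreasing_is_cvgn => n k nk.
apply: ge0_le_integral; [exact: measurableT| |exact: mea|exact: mea|].
- by move=> x _; rewrite lee_fin.
- by move=> x _; exact: nd.
Qed.

End sum_of_functionals.

(** * Density of the domain *)

Section dense.
Context {d : measure_display} {X : measurableType d} {R : realType}.
Variables (nu : {measure set X -> \bar R}) (m : X -> probability X R).
Hypotheses (hm : kernel_measurable m) (hrev : nu_reversible nu m).
Implicit Types (u v w h : X -> R) (E : set X).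

Local Notation M := (nuxm_measure nu hm).

Lemma subdiff_add (F G : (X -> R) -> \bar R) u v1 v2 :
  subdiff nu F u v1 -> subdiff nu G u v2 ->
  subdiff nu (fun u => F u + G u)%E u (v1 \+ v2).
Proof.
move=> [u2 [v12 [Fu sub1]]] [_ [v22 [Gu sub2]]].
split=> //; split; first exact: L2D.
split; first exact: lte_add_pinfty.
move=> w w2; have h2 := L2B w2 u2.
have -> : (\int[nu]_x ((v1 \+ v2) x * (w x - u x))%:E =
    \int[nu]_x (v1 x * (w x - u x))%:E + \int[nu]_x (v2 x * (w x - u x))%:E)%E.
  rewrite !rintegralE; [|exact: L2_mul|exact: L2_mul|].
    rewrite -EFinD -rintegralD; [|exact: L2_mul|exact: L2_mul].
    by congr EFin; apply: eq_Rintegral => x _; rewrite mulrDl.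
  by apply: (L2_mul (f := v1 \+ v2)) => //; exact: L2D.
by rewrite addeACA; apply: leeD; [exact: sub1|exact: sub2].
Qed.

Lemma subdiff_ae (F : (X -> R) -> \bar R) u v v' : L2 nu v' ->
  {ae nu, forall x, v x = v' x} -> subdiff nu F u v -> subdiff nu F u v'.
Proof.
move=> v'2 vv' [u2 [v2 [Fu sub]]]; split=> //; split=> //; split=> // w w2.
have h2 := L2B w2 u2; have := sub w w2; congr (_ + _ <= _)%E.
rewrite !rintegralE; [|exact: L2_mul|exact: L2_mul]; congr EFin.
apply: rintegral_ae_eq.
- exact: rintegrable_measurable (L2_mul v2 h2).
- exact: rintegrable_measurable (L2_mul v'2 h2).
- by move: vv'; apply: filterS => x ->.
Qed.

Section supported_flux.
Variables (E : set X) (g : X * X -> R) (c : R).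
Hypotheses (mE : measurable E) (Ey : (nu E < +oo)%E).
Hypotheses (mg : measurable_fun setT g) (c0 : 0 <= c).
(** Typical of a flux built from a function vanishing off [E]: its gradient is [0] on every pair
    with no endpoint in [E]. *)
Hypothesis gE : forall z, `|g z| <= c * (\1_E z.1 + \1_E z.2).

Let Ei : rintegrable nu (\1_E).
Proof. by apply: rintegrable_ge0 => //; rewrite integral_indic// setIT. Qed.

Let EEi : rintegrable M (fun z => \1_E z.1 + \1_E z.2).
Proof.
apply: rintegrableD; first exact: nuxm_rintegrable_fst.
exact: nuxm_rintegrable_snd.
Qed.

Let ind01 (S : set X) x : \1_S x = 0 :> R \/ \1_S x = 1 :> R.
Proof. by rewrite indicE; case: (_ \in _); [right|left]. Qed.

Lemma supported_flux_mul h : L2 nu h -> rintegrable M (fun z => g z * h z.1).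
Proof.
move=> /L2P[mh h2].
have i := rintegrableZ c (rintegrableD EEi (rintegrableZ 2 (nuxm_rintegrable_fst hm h2))).
apply: rintegrable_le i _.
  by apply: measurable_funM => //; exact: measurableT_comp measurable_fst.
move=> z; rewrite normrM.
apply: le_trans (ler_wpM2r (normr_ge0 _) (gE z)) _; rewrite -mulrA ler_wpM2l//.
rewrite -(real_normK (num_real (h z.1))); have h0 := normr_ge0 (h z.1).
move: `|h z.1| h0 => t t0; have := sqr_ge0 (t - 1); have := sqr_ge0 t.
by case: (ind01 E z.1) => ->; case: (ind01 E z.2) => ->; nra.
Qed.

(** Jensen's inequality in each [m x] reduces the claim to the integrability of [g^2], which is at
    most [2 c^2] times the sum of the two indicators. *)
Lemma supported_flux_L2 : L2 nu (kint m g).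
Proof.
have gi : rintegrable M (fun z => g z ^+ 2).
  apply: rintegrable_le (rintegrableZ (c ^+ 2) (rintegrableZ 2 EEi)) _.
    exact: measurable_funX.
  move=> z; rewrite ger0_norm ?sqr_ge0// -real_normK ?num_real//.
  apply: (@le_trans _ _ ((c * (\1_E z.1 + \1_E z.2)) ^+ 2)).
    by rewrite lerXn2r ?nnegrE// mulr_ge0// addr_ge0.
  rewrite exprMn ler_wpM2l ?sqr_ge0//.
  by case: (ind01 E z.1) => ->; case: (ind01 E z.2) => ->; lra.
have mg2 := rintegrable_measurable gi.
apply/L2P; split; first exact: measurable_kint.
apply: rintegrable_le_ae (kint_rintegrable mg2 gi) _.
  by apply: measurable_funX; exact: measurable_kint.
have := ae_rintegrable_section mg2 gi; apply: filterS => x gx.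
have mgx : measurable_fun setT (fun y => g (x, y)) by exact: (measurable_fun_section x).
have [i le] := probability_sqr_le mgx gx.
have gxi : rintegrable (m x) (fun y => g (x, y)).
  by apply: rintegrable_le mgx i _ => y.
rewrite ger0_norm ?sqr_ge0//; apply: le_trans le.
have h : `|kint m g x| <= \int[m x]_y `|g (x, y)| := le_normr_Rintegral measurableT gxi.
have I0 : 0 <= \int[m x]_y `|g (x, y)| by apply: Rintegral_ge0.
by rewrite -[leLHS]real_normK ?num_real// lerXn2r ?nnegrE.
Qed.

End supported_flux.

Section domain.
Variables (A B : X -> set X) (p : R).
Hypothesis mA : measurable [set z : X * X | A z.1 z.2].
Hypothesis mB : measurable [set z : X * X | B z.1 z.2].
Hypothesis p1 : 1 < p.
Hypothesis fin_or_p2 : (nu setT < +oo)%E \/ 2 <= p.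

Local Notation KA := (Kset A : X * X -> R).
Local Notation KB := (Kset B : X * X -> R).

Let mKA : measurable_fun setT KA. Proof. exact: measurable_Kset. Qed.
Let mKB : measurable_fun setT KB. Proof. exact: measurable_Kset. Qed.
Let KA0 z : 0 <= KA z. Proof. exact: Kset_ge0. Qed.
Let KA1 z : KA z <= 1. Proof. exact: Kset_le1. Qed.
Let KB0 z : 0 <= KB z. Proof. exact: Kset_ge0. Qed.
Let KB1 z : KB z <= 1. Proof. exact: Kset_le1. Qed.
Let KBs z : KB (z.2, z.1) = KB z. Proof. exact: Kset_sym. Qed.

Lemma measurable_sg : measurable_fun setT (@Num.sg R).
Proof.
rewrite (_ : Num.sg = (fun t : R => \1_(`]0, +oo[%classic) t - \1_(`]-oo, 0[%classic) t)).
  by apply: measurable_funB; apply: measurable_indic; exact: measurable_itv.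
apply/funext => t; rewrite !indicE !mem_setE !in_itv/= andbT.
case: (ltgtP t 0) => [h|h|->].
- by rewrite ltr0_sg// sub0r.
- by rewrite gtr0_sg// subr0.
- by rewrite sgr0 subrr.
Qed.

Lemma supported_domain E u (c : R) : measurable E -> (nu E < +oo)%E ->
  measurable_fun setT u -> (forall x, `|u x| <= c) -> (forall x, ~ E x -> u x = 0) ->
  exists v, subdiff nu (fun u => FA1 nu m A u + FBp nu m B p u)%E u v.
Proof.
move=> mE Ey mu uc uE.
have [[x0 _]|X0] := pselect (exists x : X, True); last first.
  by exfalso; apply: X0; exists point.
have c0 : 0 <= c by exact: (le_trans (normr_ge0 _) (uc x0)).
have E2 := L2_indic mE Ey.
have ind0 x : 0 <= \1_E x :> R by [].
have uI x : `|u x| <= c * \1_E x.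
  have [Ex|nEx] := pselect (E x); first by rewrite indicE mem_set// mulr1.
  by rewrite uE// normr0 mulr_ge0.
have u2 : L2 nu u.
  apply: L2_norm_le mu (L2Z c E2) _ => x.
  by rewrite [leRHS]ger0_norm ?mulr_ge0.
have gI z : `|grad u z| <= c * (\1_E z.1 + \1_E z.2).
  rewrite /grad (le_trans (ler_normB _ _))// mulrDr addrC.
  by rewrite lerD.
have Ei : rintegrable nu (\1_E).
  by apply: rintegrable_ge0 => //; rewrite integral_indic// setIT.
have EEi : rintegrable M (fun z => \1_E z.1 + \1_E z.2).
  apply: rintegrableD; first exact: nuxm_rintegrable_fst.
  exact: nuxm_rintegrable_snd.
have gnz z : grad u z != 0 -> 1 <= \1_E z.1 + \1_E z.2 :> R.
  move=> gz; have [E1|nE1] := pselect (E z.1).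
    by rewrite [X in X + _]indicE mem_set// lerDl.
  have [F2|nE2] := pselect (E z.2).
    by rewrite [X in _ + X]indicE mem_set// lerDr.
  by move: gz; rewrite /grad !uE// subrr eqxx.
(* [Num.sg] selects [0] among the subgradients of the absolute value at [0]. This choice is odd, so
   [gA] is antisymmetric, and it makes [gA] vanish wherever [grad u] does. *)
pose gA z := Num.sg (grad u z) * KA z.
have mgA : measurable_fun setT gA.
  apply: measurable_funM => //.
  exact: measurableT_comp measurable_sg (measurable_grad mu).
have gAE z : `|gA z| <= 1 * (\1_E z.1 + \1_E z.2).
  rewrite mul1r; have [g0|gz] := eqVneq (grad u z) 0.
    by rewrite /gA g0 sgr0 mul0r normr0 addr_ge0.
  apply: le_trans (gnz z gz); rewrite normrM normr_sg gz mul1r.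
  by rewrite ger0_norm.
have gAanti z : gA (z.2, z.1) = - gA z.
  by rewrite /gA (Kset_sym A z) -mulNr -sgrN /grad opprB.
have A2 : L2 nu (kint m gA) by exact: (supported_flux_L2 mE Ey mgA ler01 gAE).
have subA : subdiff nu (FA1 nu m A) u (fun x => - kint m gA x).
  have half0 : 0 < 2^-1 :> R by rewrite invr_gt0.
  have ui : rintegrable M (fun z => `|grad u z| * KA z).
    apply: rintegrable_le (rintegrableZ c EEi) _.
      by apply: (measurable_density (phi := fun t : R => `|t|)).
    move=> z; rewrite normrM normr_id (ger0_norm (KA0 z)).
    by apply: le_trans (gI z); rewrite ler_piMr.
  have sgsub (s t : R) : `|t| + 1 * (Num.sg t * (s - t)) <= `|s|.
    rewrite mul1r mulrBr -[X in _ - X]normrEsg addrC subrK.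
    apply: le_trans (ler_norm _) _; rewrite normrM normr_sg.
    by case: (t != 0); rewrite ?mul1r ?mul0r.
  apply: (@subdiff_energy _ _ _ nu m hm (fun t : R => `|t|) KA
    (@normr_measurable R setT) (@normr_ge0 _ _) mKA KA0 Num.sg _ 1 u _ half0
    (mulr1 _) sgsub u2 (L2N A2) ui).
  move=> w w2 _; have h2 := L2B w2 u2.
  pose h x := w x - u x.
  have gh : rintegrable M (fun z => gA z * h z.1).
    exact: (supported_flux_mul mE Ey mgA ler01 gAE h2).
  have ki := rintegrable_kint_mul mgA gh.
  split; first exact: (rintegrable_grad_antisym hrev gAanti gh).
  rewrite (integration_by_parts hrev mgA gAanti gh).
  have := rintegralN ki; under eq_Rintegral do rewrite -mulNr.
  by move=> ->; lra.
have cp0 : 0 <= (2 * c) `^ (p - 1) by exact: powR_ge0.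
have pu : pfin nu hm KB p u := pfin_bounded hm hrev mKB KB0 KB1 p1 fin_or_p2 u2 uc.
have gBE z : `|pflux KB p u z| <= (2 * c) `^ (p - 1) * (\1_E z.1 + \1_E z.2).
  rewrite /pflux; move: (KB z) (KB0 z) (KB1 z) => k k0 k1.
  have [g0|gz] := eqVneq (grad u z) 0.
    by rewrite g0 /psi mulr0 mul0r normr0 mulr_ge0// addr_ge0.
  rewrite normrM norm_psi// (ger0_norm k0).
  apply: le_trans (ler_piMr (powR_ge0 _ _) k1) _.
  apply: (@le_trans _ _ ((2 * c) `^ (p - 1) * 1)); last first.
    by apply: ler_wpM2l => //; exact: gnz.
  rewrite mulr1; apply: ge0_ler_powR; rewrite ?nnegrE ?mulr_ge0//.
    by rewrite subr_ge0 ltW.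
  rewrite /grad (le_trans (ler_normB _ _))//.
  by have := uc z.1; have := uc z.2; lra.
have B2 : L2 nu (kint m (pflux KB p u)).
  exact: (supported_flux_L2 mE Ey (measurable_pflux mKB p1 mu) cp0 gBE).
have subB := subdiff_pflux hrev mKB KB0 KB1 KBs p1 fin_or_p2 u2 pu B2.
by eexists; exact: subdiff_add subA subB.
Qed.

Lemma subdiff_dense :
  dense_domain nu (subdiff nu (fun u => FA1 nu m A u + FBp nu m B p u)%E).
Proof.
move=> f f2 e e0; have /L2P[mf fi] := f2.
(* The lower bound on [|f|] makes the measure of [E n] finite by Chebyshev's inequality; the upper
   bound makes the truncated function bounded. *)
pose E n := [set x | n.+1%:R^-1 < `|f x| <= n%:R].
have mE n : measurable (E n).
  have mnf : measurable_fun setT (fun x => `|f x|) by exact: measurableT_comp.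
  rewrite (_ : E n = setT `&` (fun x => `|f x|) @^-1` [set` `]n.+1%:R^-1, n%:R]]).
    by apply: mnf => //; exact: measurable_itv.
  by rewrite setTI; apply/seteqP; split=> x /=; rewrite in_itv.
pose u n x := f x * \1_(E n) x.
have mu n : measurable_fun setT (u n).
  by apply: measurable_funM => //; exact: measurable_indic.
have Ey n : (nu (E n) < +oo)%E.
  have i := rintegrableZ (n.+1%:R ^+ 2) fi.
  apply: le_lt_trans (rintegrable_lty i).
  rewrite -[nu _](_ : \int[nu]_x (\1_(E n) x)%:E = _)%E; last first.
    by rewrite integral_indic// setIT.
  apply: ge0_le_integral => //.
  - by apply/measurable_EFinP; exact: measurable_indic.
  - exact: measurable_int i.
  move=> x _; rewrite lee_fin indicE; have [|_] := boolP (x \in _); last first.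
    by rewrite mulr_ge0 ?sqr_ge0.
  rewrite inE => -[/= /andP[h _]].
  rewrite -exprMn -[leRHS]real_normK ?num_real// normrM ger0_norm//.
  rewrite -[leLHS](expr1n R 2) lerXn2r ?nnegrE ?mulr_ge0//.
  rewrite -[leLHS](@mulfV _ (n.+1%:R : R)) ?pnatr_eq0// ler_wpM2l//; exact: ltW.
have uc n x : `|u n x| <= n%:R.
  rewrite /u normrM indicE; have [|_] := boolP (x \in _).
    by rewrite inE => -[/= /andP[_ h]]; rewrite normr1 mulr1.
  by rewrite normr0 mulr0.
have uE n x : ~ E n x -> u n x = 0.
  by move=> nE; rewrite /u indicE memNset// mulr0.
have cv x : (u n x - f x) ^+ 2 @[n --> \oo] --> (0 : R).
  have [f0|f0] := eqVneq (f x) 0.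
    by apply: cvg_near_cst; apply: nearW => n; rewrite /u f0 mul0r subrr expr0n.
  have h : 0 < `|f x| by rewrite normr_gt0.
  apply: cvg_near_cst; near=> n.
  rewrite /u indicE mem_set ?mulr1 ?subrr ?expr0n//=; apply/andP; split.
    by near: n; exact: near_infty_natSinv_lt (PosNum h).
  by near: n; exact: nbhs_infty_ger.
have dle n x : `|(u n x - f x) ^+ 2| <= f x ^+ 2.
  rewrite ger0_norm ?sqr_ge0// /u indicE.
  case: (x \in _); rewrite ?mulr1 ?subrr ?expr0n ?sqr_ge0//=.
  by rewrite mulr0 sub0r sqrrN.
have mdf n : measurable_fun setT (fun x => (u n x - f x) ^+ 2).
  by apply: measurable_funX; exact: measurable_funB.
have [_ L] := rdominated_convergence mdf cv fi dle.
rewrite (Rintegral_cst nu measurableT 0) mul0r in L.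
have /cvgr_lt/(_ _ e0) := L => -[N _ /(_ N (leqnn N)) lt_e].
have [v uv] := supported_domain (mE N) (Ey N) (mu N) (uc N) (uE N).
exists (u N), v; split=> //.
under eq_integral do rewrite real_normK ?num_real//.
rewrite rintegralE ?lte_fin//.
exact: rintegrable_le (mdf N) fi (dle N).
Unshelve. all: by end_near. Qed.

End domain.

End dense.

(** * The p-Laplacian and the theorem *)

Section p_laplacian.
Context {d : measure_display} {X : measurableType d} {R : realType}.
Variables (nu : {measure set X -> \bar R}) (m : X -> probability X R).
Hypotheses (hm : kernel_measurable m) (hrev : nu_reversible nu m).
Hypothesis nu_sfin : sigma_finite setT nu.
Variables (B : X -> set X) (p : R).
Hypothesis mB : measurable [set z : X * X | B z.1 z.2].
Hypothesis p1 : 1 < p.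
Hypothesis fin_or_p2 : (nu setT < +oo)%E \/ 2 <= p.
Implicit Types (u v w h : X -> R).

Local Notation M := (nuxm_measure nu hm).
Local Notation KB := (Kset B : X * X -> R).
Local Notation lap u := (kint m (pflux KB p u)).

Let mKB : measurable_fun setT KB. Proof. exact: measurable_Kset. Qed.
Let KB0 z : 0 <= KB z. Proof. exact: Kset_ge0. Qed.
Let KB1 z : KB z <= 1. Proof. exact: Kset_le1. Qed.
Let KBs z : KB (z.2, z.1) = KB z. Proof. exact: Kset_sym. Qed.

Lemma subdiff_FBp_lap u : L2 nu u -> pfin nu hm KB p u -> L2 nu (lap u) ->
  subdiff nu (FBp nu m B p) u (fun x => - lap u x).
Proof.
by move=> u2 ui l2; exact: (subdiff_pflux hrev mKB KB0 KB1 KBs p1 fin_or_p2 u2 ui l2).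
Qed.

Let FA0 w : FA1 nu m (fun=> set0) w = 0%E.
Proof.
rewrite /FA1 [X in (_ * X)%E](_ : _ = 0%E) ?mule0//.
apply: integral0_eq => x _; apply: integral0_eq => y _.
by rewrite /Kset !indic0 addr0 !mulr0.
Qed.

Let F0 : (fun u => FA1 nu m (fun=> set0) u + FBp nu m B p u)%E = FBp nu m B p.
Proof. by apply/funext => u; rewrite FA0 add0e. Qed.

(* With an empty [A] the first functional vanishes, and the subdifferential of
   [0] is reduced to [0]. *)
Lemma subdiff_FBp_ae u v : subdiff nu (FBp nu m B p) u v ->
  L2 nu (lap u) /\ {ae nu, forall x, v x = - lap u x}.
Proof.
rewrite -{1}F0 => uv; have [u2 [v2 _]] := uv.
have m0 : measurable [set z : X * X | (fun=> set0 : set X) z.1 z.2].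
  exact: measurable0.
have l2 := subdiff_lap_L2 hm hrev nu_sfin m0 mB p1 fin_or_p2 uv.
split=> //.
have [_ [z2 [_ sub]]] := subdiff_split hm hrev nu_sfin m0 mB p1 fin_or_p2 uv.
have := sub _ (L2D u2 z2).
rewrite !FA0 add0e.
have -> : (fun x => ((v x + lap u x) * (u x + (v x + lap u x) - u x))%:E) =
    (fun x => ((v x + lap u x) ^+ 2)%:E).
  by apply/funext => x; congr EFin; ring.
have /L2P[_ z2'] := z2; rewrite rintegralE// lee_fin => le0.
have := rintegral_ge0_eq0 z2' (fun x => sqr_ge0 _) le0.
by apply: filterS => x /eqP; rewrite sqrf_eq0 addr_eq0 => /eqP.
Qed.

Lemma subdiff_FBpE : subdiff nu (FBp nu m B p) = opneg (Lapp nu m B p).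
Proof.
have p0 : 0 < p by exact: lt_trans p1.
have c0 : 0 < (2 * p)^-1 by rewrite invr_gt0 mulr_gt0.
have nuxmE u : nuxm nu m (fun z => (KB z * `|grad u z| `^ p)%:E) =
    energy nu m (fun t : R => `|t| `^ p) KB u.
  by congr nuxm; apply/funext => z; rewrite mulrC.
have mpow := @measurable_pow R p.
have pw0 (t : R) : 0 <= `|t| `^ p by exact: powR_ge0.
apply/funext => u; apply/funext => v; apply/propext; split.
  move=> uv; have [u2 [v2 [Fu _]]] := uv; have mu := L2_measurable u2.
  have [l2 lv] := subdiff_FBp_ae uv.
  have pu := (cenergy_ltyP nu hm mpow pw0 mKB KB0 c0 mu).1 Fu.
  split=> //; split; first exact: L2N.
  split; first by rewrite nuxmE; exact/(energy_ltyP nu hm mpow pw0 mKB KB0 mu).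
  have mp := rintegrable_measurable pu.
  (* [Lapp] is stated with an extended integral; identifying it with [lap u x] requires an
     integrable section of the flux. Almost everywhere it is dominated by [1 + |grad u|^p K], as
     [m x] is a probability. *)
  apply: filterS2 lv (ae_rintegrable_section mp pu) => x lvx pux.
  have mfx : measurable_fun setT (fun y => pflux KB p u (x, y)).
    by apply: (measurable_fun_section x); exact: measurable_pflux.
  have c1 : rintegrable (m x) (fun=> 1).
    apply/integrableP; split; first exact/measurable_EFinP.
    by rewrite /= integral_cst//= lte_mul_pinfty// probability_setT ltry.
  have fi : rintegrable (m x) (fun y => pflux KB p u (x, y)).
    apply: rintegrable_le mfx (rintegrableD c1 pux) _ => y; rewrite /pflux.
    move: (KB (x, y)) (KB0 (x, y)) (KB1 (x, y)) => k k0 k1.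
    rewrite normrM norm_psi// (ger0_norm k0).
    apply: le_trans (ler_wpM2r k0 (powRB1_le _ p1)) _.
    by rewrite mulrDl mul1r lerD2r.
  rewrite /= lvx opprK rintegralE.
    by congr EFin; apply: eq_Rintegral => y _; rewrite /pflux /psi; ring.
  by move: fi; congr (rintegrable _ _); apply/funext => y; rewrite /pflux /psi; ring.
move=> [u2 [v2 [pu lv]]]; have mu := L2_measurable u2.
have {}v2 : L2 nu v by move: (L2N v2); under eq_fun do rewrite opprK.
have {}pu : pfin nu hm KB p u.
  by apply/(energy_ltyP nu hm mpow pw0 mKB KB0 mu); rewrite -nuxmE.
have {}lv : {ae nu, forall x, v x = - lap u x}.
  (* Here the extended integral is equal to a real number, so passing to [fine] loses nothing. *)
  move: lv; apply: filterS => x /(congr1 fine) /= lvx; rewrite -[LHS]opprK lvx.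
  by congr (- _); apply: eq_Rintegral => y _; rewrite /pflux /psi; ring.
have l2 : L2 nu (lap u).
  have ml : measurable_fun setT (lap u).
    by apply: (measurable_kint hm); exact: measurable_pflux.
  apply: L2_ae_eq ml _ (L2N v2).
  by move: lv; apply: filterS => x ->; rewrite opprK.
apply: subdiff_ae v2 _ (subdiff_FBp_lap u2 pu l2).
by move: lv; apply: filterS => x ->.
Qed.

End p_laplacian.

Lemma subdiff_FA1E {d : measure_display} {X : measurableType d} {R : realType}
    (nu : {measure set X -> \bar R}) (m : X -> probability X R) (A : X -> set X) :
  subdiff nu (FA1 nu m A) = opneg (Lap1 nu m A).
Proof.
apply/funext => u; apply/funext => v; rewrite /opneg /Lap1.
by congr (subdiff _ _ _ _); apply/funext => x /=; rewrite opprK.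
Qed.

Theorem theorem4p3 (d : measure_display) (X : measurableType d) (R : realType)
  (m : X -> probability X R) (nu : {measure set X -> \bar R})
  (A B : X -> set X) (p : R) :
  countably_generated (X := X) ->
  kernel_measurable m ->
  sigma_finite setT nu ->
  nu_invariant nu m ->
  nu_reversible nu m ->
  1 < p ->
  measurable [set xy : X * X | A xy.1 xy.2] ->
  measurable [set xy : X * X | B xy.1 xy.2] ->
  (forall x, measurable (A x) /\ measurable (B x) /\
     (0 < m x (A x))%E /\ (0 < m x (B x))%E /\
     m x (~` (A x `|` B x)) = 0%E) ->
  ((nu setT < +oo)%E \/ (nu setT = +oo%E /\ 2 <= p)) ->
  let F := fun u => (FA1 nu m A u + FBp nu m B p u)%E in
  subdiff nu F = opadd (subdiff nu (FA1 nu m A)) (subdiff nu (FBp nu m B p)) /\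
  opadd (subdiff nu (FA1 nu m A)) (subdiff nu (FBp nu m B p))
    = opadd (opneg (Lap1 nu m A)) (opneg (Lapp nu m B p)) /\
  completely_accretive nu (subdiff nu F) /\
  dense_domain nu (subdiff nu F).
Proof.
move=> _ hm nu_sfin _ hrev p1 mA mB _ case_ab F.
have fin_or_p2 : (nu setT < +oo)%E \/ 2 <= p by case: case_ab => [|[]]; [left|right].
split; last split; last split.
- apply/funext => u; apply/funext => v; apply/propext; split; last first.
    by move=> [v1 [v2 [s1 [s2 ->]]]]; exact: subdiff_add.
  move=> uv; have [u2 [v2 [Fu _]]] := uv.
  have [_ pu] := (F_ltyP nu hm mA mB p1 (L2_measurable u2)).1 Fu.
  have l2 := subdiff_lap_L2 hm hrev nu_sfin mA mB p1 fin_or_p2 uv.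
  exists (fun x => v x + kint m (pflux (Kset B) p u) x).
  exists (fun x => - kint m (pflux (Kset B) p u) x).
  split; first exact: (subdiff_split hm hrev nu_sfin mA mB p1 fin_or_p2 uv).
  split; first exact: (subdiff_FBp_lap hrev mB p1 fin_or_p2 u2 pu l2).
  by apply/funext => x /=; rewrite addrK.
- by rewrite -subdiff_FA1E (subdiff_FBpE hm hrev nu_sfin mB p1 fin_or_p2).
- exact: (subdiff_completely_accretive hm mA mB p1).
- exact: (subdiff_dense hm hrev mA mB p1 fin_or_p2).
Qed.
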